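(* Let $(Y_i,R_i,X_i)$, $i=1,\dots,n$, be i.i.d. copies of $(Y,R,X)\in\mathbb{R}\times\{0,1\}\times\mathbb{R}^d$ with $Y=X^T\beta_0+\epsilon$, $\mathrm{E}(\epsilon\mid X)=0$, $\mathrm{E}(\epsilon^2\mid X)=\sigma_\epsilon^2$, where $\beta_0\in\mathbb{R}^d$ has support $S_\beta$ with $s_\beta=|S_\beta|$, and with $R$ conditionally independent of $Y$ given $X$. Assume that $X$ is sub-Gaussian in the sense that $\|u^TX\|_{\psi_2}\lesssim(\mathrm{E}[(u^TX)^2])^{1/2}$ for all $u\in\mathbb{R}^d$, and that the restricted eigenvalue condition $$\inf_{v\in\mathcal{C}_1(S_\beta,3)\cap\mathbb{S}^{d-1}}\mathrm{E}[R(X^Tv)^2]\ge\kappa_R^2$$ holds for some $\kappa_R>0$. Let $\hat\beta$ be the complete-case Lasso estimator $$\hat\beta=\arg\min_{\beta\in\mathbb{R}^d}\Big[\frac1n\sum_{i=1}^nR_i(Y_i-X_i^T\beta)^2+\lambda\|\beta\|_1\Big],\qquad\lambda>0.$$ There exist absolute constants $A_1,A_2>0$ such that the following holds. Let $\delta\in(0,1)$ and suppose $n$ is large enough that $$\sqrt{\frac{s_\beta\log(ed/s_\beta)}{n}}+\sqrt{\frac{\log(1/\delta)}{n}}<\min\Big\{\frac{\kappa_R^2}{A_1\phi_{s_\beta}},1\Big\}.$$ (a) If $\lambda>\frac4n\big\|\sum_{i=1}^nR_iX_i\epsilon_i\big\|_\infty>0$ and $d\ge s_\beta+2$, then with probability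 at least $1-\delta$, $\|\hat\beta-\beta_0\|_2\lesssim\frac{\sqrt{s_\beta}\,\lambda}{\kappa_R^2}$. (b) If, in addition, $\|\epsilon\|_{\psi_2}\lesssim\sigma_\epsilon$ and $\lambda=A_2\sigma_\epsilon\sqrt{\frac{\phi_1\log(d/\delta)}{n}}$, then with probability at least $1-\delta$, $$\|\hat\beta-\beta_0\|_2\lesssim\frac{\sigma_\epsilon}{\kappa_R^2}\sqrt{\frac{\phi_1s_\beta\log(d/\delta)}{n}}.$$
   Context: $\epsilon_i=Y_i-X_i^T\beta_0$. The $\psi_\alpha$-Orlicz norm of a random variable $Z$ is $\|Z\|_{\psi_\alpha}=\inf\{t>0:\mathrm{E}\exp(|Z|^\alpha/t^\alpha)\le2\}$. The notation $a\lesssim b$ means $a\le Cb$ for an absolute constant $C>0$. $\mathbb{S}^{d-1}$ is the unit sphere in $\mathbb{R}^d$. For $S\subset\{1,\dots,d\}$, $\vartheta\ge0$, $q\ge1$, the cone is $\mathcal{C}_q(S,\vartheta)=\{v\in\mathbb{R}^d:\|v_{S^c}\|_q\le\vartheta\|v_S\|_q\}$, where $v_S$ is the subvector indexed by $S$. The $s$-sparse maximum eigenvalue is $\phi_s=\sup_{u\in\mathbb{S}^{d-1},\|u\|_0\le s}\mathrm{E}[(X^Tu)^2]$. *)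

(* Defs.v *)
From HB Require Import structures.
From mathcomp Require Import all_boot all_order all_algebra.
From mathcomp Require Import all_classical all_reals all_analysis.
Set Implicit Arguments. Unset Strict Implicit. Unset Printing Implicit Defensive.
Import Order.TTheory GRing.Theory Num.Theory.
Import numFieldNormedType.Exports.
Local Open Scope classical_set_scope.
Local Open Scope ring_scope.

Section vectors.
Context {R : realType}.
Definition dotv {d : nat} (u v : 'I_d -> R) : R := \sum_(j < d) u j * v j.
Definition norm1 {d : nat} (v : 'I_d -> R) : R := \sum_(j < d) `|v j|.
Definition norm2 {d : nat} (v : 'I_d -> R) : R := Num.sqrt (\sum_(j < d) v j ^+ 2).
Definition norminf {d : nat} (v : 'I_d -> R) : R := \big[Num.max/0]_(j < d) `|v j|.
Definition norm0 {d : nat} (v : 'I_d -> R) : nat := #|[pred j | v j != 0]|.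
Definition cone1 {d : nat} (S : pred 'I_d) (theta : R) (v : 'I_d -> R) : Prop :=
  \sum_(j < d | ~~ S j) `|v j| <= theta * \sum_(j < d | S j) `|v j|.
Definition supp {d : nat} (v : 'I_d -> R) : pred 'I_d := [pred j | v j != 0].
End vectors.

Section prob_defs.
Context {dsp : measure_display} {T : measurableType dsp} {R : realType}.
Variable P : probability T R.

Definition at_ {d : nat} (X : 'I_d -> T -> R) (w : T) : 'I_d -> R := fun j => X j w.

Definition cylX {d : nat} (X : 'I_d -> T -> R) : set (set T) :=
  [set [set w | forall j, C j (X j w)] | C in
     [set C : 'I_d -> set R | forall j, measurable (C j)]].

Definition sigmaX {d : nat} (X : 'I_d -> T -> R) : set (set T) := <<s cylX X >>.

Definition sigmaX_measurable {d : nat} (X : 'I_d -> T -> R) (g : T -> R) : Prop :=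
  forall B : set R, measurable B -> sigmaX X (g @^-1` B).

Definition cond_exp_version {d : nat} (X : 'I_d -> T -> R) (Z g : T -> R) : Prop :=
  [/\ P.-integrable setT (EFin \o Z),
      sigmaX_measurable X g,
      P.-integrable setT (EFin \o g) &
      forall D, sigmaX X D ->
        (\int[P]_(w in D) (Z w)%:E = \int[P]_(w in D) (g w)%:E)%E].

Definition cond_indep_given {d : nat} (X : 'I_d -> T -> R) (U V : T -> R) : Prop :=
  forall A B : set R, measurable A -> measurable B ->
  exists gA gB gAB : T -> R,
    [/\ cond_exp_version X (\1_(U @^-1` A)) gA,
        cond_exp_version X (\1_(V @^-1` B)) gB,
        cond_exp_version X (fun w => \1_(U @^-1` A) w * \1_(V @^-1` B) w) gAB &
        {ae P, forall w, gAB w = gA w * gB w}].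

Definition cyl3 {d : nat} (Y Rv : T -> R) (X : 'I_d -> T -> R)
  (A B : set R) (C : 'I_d -> set R) : set T :=
  [set w | A (Y w) /\ B (Rv w) /\ forall j, C j (X j w)].

(* (Ys i, Rs i, Xs i), i < n, are i.i.d. copies of (Y, Rv, X):
   same law as (Y, Rv, X), and mutually independent (product rule on the
   generating pi-system of rectangles; taking full sets gives subfamilies) *)
Definition iid_copies {d n : nat} (Ys Rs : 'I_n -> T -> R) (Xs : 'I_n -> 'I_d -> T -> R)
  (Y Rv : T -> R) (X : 'I_d -> T -> R) : Prop :=
  (forall (i : 'I_n) (A B : set R) (C : 'I_d -> set R),
     measurable A -> measurable B -> (forall j, measurable (C j)) ->
     P (cyl3 (Ys i) (Rs i) (Xs i) A B C) = P (cyl3 Y Rv X A B C)) /\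
  (forall (A B : 'I_n -> set R) (C : 'I_n -> 'I_d -> set R),
     (forall i, measurable (A i)) -> (forall i, measurable (B i)) ->
     (forall i j, measurable (C i j)) ->
     P (\bigcap_i cyl3 (Ys i) (Rs i) (Xs i) (A i) (B i) (C i)) =
     (\prod_(i < n) fine (P (cyl3 (Ys i) (Rs i) (Xs i) (A i) (B i) (C i))))%:E).

(* psi_2 Orlicz norm: inf { t > 0 : E exp(Z^2/t^2) <= 2 } (+oo if empty) *)
Definition psi2 (Z : T -> R) : \bar R :=
  ereal_inf [set t%:E | t in [set t : R | 0 < t /\
     ('E_P[fun w => (expR (Z w ^+ 2 / t ^+ 2))%R] <= 2%:E)%E]].

Definition phi_sparse {d : nat} (X : 'I_d -> T -> R) (s : nat) : R :=
  fine (ereal_sup [set ('E_P[fun w => (dotv (at_ X w) u ^+ 2)%R])%E | u in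
          [set u : 'I_d -> R | norm2 u = 1 /\ (norm0 u <= s)%N]]).

Definition lasso_obj {d n : nat} (Ys Rs : 'I_n -> T -> R) (Xs : 'I_n -> 'I_d -> T -> R)
  (lam : R) (w : T) (b : 'I_d -> R) : R :=
  n%:R^-1 * (\sum_(i < n) Rs i w * (Ys i w - dotv (at_ (Xs i) w) b) ^+ 2)
  + lam * norm1 b.

Definition is_lasso {d n : nat} (Ys Rs : 'I_n -> T -> R) (Xs : 'I_n -> 'I_d -> T -> R)
  (lam : R) (w : T) (b : 'I_d -> R) : Prop :=
  forall b' : 'I_d -> R, lasso_obj Ys Rs Xs lam w b <= lasso_obj Ys Rs Xs lam w b'.
End prob_defs.

(* Main.v *)
Require Import Defs.
From HB Require Import structures.
From mathcomp Require Import all_boot all_order all_algebra.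
From mathcomp Require Import all_classical all_reals all_analysis.
From mathcomp Require Import measurable_realfun.
From mathcomp Require Import ring lra zify.
Import Order.TTheory GRing.Theory Num.Theory.
Import numFieldNormedType.Exports.
Local Open Scope classical_set_scope.
Local Open Scope ring_scope.

(** Write Sigma = E[X X^T], Sigma_R = E[R X X^T] and Sigma_n for its empirical version. Bernstein bounds
    for sub-exponential variables give, simultaneously for all integer vectors z of l1 norm at most s+1 and
    with no covering argument, a lower bound of z^T Sigma_n z by z^T Sigma_R z - eta z^T Sigma z; up to
    homogeneity there are only exp(O(s log(ed/s))) such z. Maurey's empirical method writes any v as a mean
    of a random vector of this kind, and averaging a quadratic form over it reproduces v^T Sigma_n v up to
    a diagonal term that is controlled by |v|_1^2 / s. On the cone |v|_1^2 <= 16 s |v|_2^2, so the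
    restricted eigenvalue condition passes from Sigma_R to Sigma_n, and the usual basic inequality for the
    Lasso gives (a). For (b), the noise R X_j eps is sub-exponential, and it is centred because E[R | X] may
    replace R in front of any function of (X, Y). *)

(** * Transfer of integrals along pi-systems *)

(** Each deviation is measured against the variance z^T Sigma z of its own vector, so nothing is
    normalised to a sphere, which is why no net appears, and phi is never asked for a sparsity level
    above s. Maurey's averaging needs a lower bound of z^T Sigma_n z on words only, together with an
    upper bound of the d diagonal entries of Sigma_n for its diagonal term. With eta = 112 K^2 tau,
    where 112 = 28 * 4 is the Chernoff deviation times the factor produced by doubling the Orlicz
    norm, the loss on the cone is eta phi (1 + 3 * 16) |v|_2^2; asking it to be at most half of
    kappa^2 |v|_2^2 gives A1 = 98 * 112 K^2. Likewise A2 = 4 * 28 * 4 K^2. On the measure-theoretic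
    side, i.i.d. sampling, E(eps | X) = 0 and conditional independence are all given on sets only,
    be it rectangles or events of sigma(X); a single comparison lemma turns each of them into a
    statement about integrals of functions. *)

Section transfer.
Import HBNNSimple.
Context {dsp : measure_display} {T : measurableType dsp} {R : realType}.
Variable P : probability T R.
Context {T0 : pointedType} (G : set (set T0)).
Notation GT := (g_sigma_algebraType G).
Variables (Phi Psi : T -> GT) (U V : T -> R).
Hypotheses (mPhi : measurable_fun setT Phi) (mPsi : measurable_fun setT Psi).
Hypotheses (mU : measurable_fun setT U) (mV : measurable_fun setT V).
Hypotheses (U0 : forall w, 0 <= U w) (V0 : forall w, 0 <= V w).
Hypothesis Ufin : (\int[P]_w (U w)%:E < +oo)%E.
Hypotheses (GI : setI_closed G) (GsetT : G setT).
Hypothesis GUV : forall B, G B ->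
  (\int[P]_(w in Phi @^-1` B) (U w)%:E = \int[P]_(w in Psi @^-1` B) (V w)%:E)%E.

Let mpre (F : T -> GT) (mF : measurable_fun setT F) (B : set GT) :
  measurable B -> measurable (F @^-1` B).
Proof. by move=> mB; rewrite -[X in measurable X]setTI; exact: mF. Qed.

Lemma transfer_set (B : set GT) : measurable B ->
  (\int[P]_(w in Phi @^-1` B) (U w)%:E = \int[P]_(w in Psi @^-1` B) (V w)%:E)%E.
Proof.
have mEU D : measurable_fun D (fun w => (U w)%:E).
  by apply/measurable_EFinP; exact: measurable_funS mU.
have mEV D : measurable_fun D (fun w => (V w)%:E).
  by apply/measurable_EFinP; exact: measurable_funS mV.
have UVT := GUV _ GsetT; rewrite !preimage_setT in UVT.
move=> mB.
apply: (@dynkin_induction _ GT G (fun B => (\int[P]_(w in Phi @^-1` B) (U w)%:E =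
  \int[P]_(w in Psi @^-1` B) (V w)%:E)%E)) => //.
- move=> S mS PS.
  have split1 (F : T -> GT) (W : T -> R) : measurable_fun setT F ->
      measurable_fun setT W -> (forall w, 0 <= W w) ->
      (\int[P]_w (W w)%:E = \int[P]_(w in F @^-1` S) (W w)%:E
        + \int[P]_(w in F @^-1` (~` S)) (W w)%:E)%E.
    move=> mF mW W0.
    rewrite -(ge0_integral_setU P) //; first by rewrite -preimage_setU setUv preimage_setT.
    + exact: mpre.
    + by apply: mpre => //; exact: measurableC.
    + by apply/measurable_EFinP; exact: measurable_funS mW.
    + by move=> w _; rewrite lee_fin.
    + by rewrite disj_set2E -preimage_setI setICr preimage_set0.
  have e1 := split1 Phi U mPhi mU U0; have e2 := split1 Psi V mPsi mV V0.
  (* Complements are handled by subtraction, which in the extended reals requires a finite mass;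
     this is the role of [Ufin]. *)
  have fS : (\int[P]_(w in Phi @^-1` S) (U w)%:E)%E \is a fin_num.
    rewrite ge0_fin_numE; last by apply: integral_ge0 => w _; rewrite lee_fin.
    apply: le_lt_trans Ufin; apply: ge0_subset_integral => //; first exact: mpre.
    by move=> w _; rewrite lee_fin.
  rewrite addeC in e1; rewrite addeC in e2; rewrite -PS in e2.
  by rewrite -[LHS](addeK _ fS) -e1 UVT e2 addeK.
- move=> F mF tF PF.
  rewrite !preimage_bigcup ge0_integral_bigcup //; last 3 first.
  + by move=> k; exact: mpre.
  + by move=> w _; rewrite lee_fin.
  + by move=> i j _ _ [w [Fi Fj]]; apply: tF => //; eexists; split; [exact: Fi|exact: Fj].
  rewrite ge0_integral_bigcup //; last 3 first.
  + by move=> k; exact: mpre.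
  + by move=> w _; rewrite lee_fin.
  + by move=> i j _ _ [w [Fi Fj]]; apply: tF => //; eexists; split; [exact: Fi|exact: Fj].
  by apply: eq_eseriesr => i _; exact: PF.
Qed.

(* With [Phi = Psi = id] this compares the densities [U] and [V] on a sub-sigma-algebra; with [U = V = 1]
   it compares the laws of [Phi] and [Psi]. *)
Lemma transfer_integral (h : GT -> R) : measurable_fun setT h ->
  (forall x, 0 <= h x) ->
  (\int[P]_w (h (Phi w) * U w)%:E = \int[P]_w (h (Psi w) * V w)%:E)%E.
Proof.
move=> mh h0.
have mEh : measurable_fun setT (fun x => (h x)%:E) by exact/measurable_EFinP.
have h0' t : [set: GT] t -> (0 <= (h t)%:E)%E by move=> _; rewrite lee_fin.
pose g := nnsfun_approx measurableT mEh.
have simple_case (f : {nnsfun GT >-> R}) (F : T -> GT) (W : T -> R) :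
    measurable_fun setT F -> measurable_fun setT W -> (forall w, 0 <= W w) ->
    (\int[P]_w (f (F w) * W w)%:E =
     \sum_(y \in range f) y%:E * \int[P]_(w in F @^-1` (f @^-1` [set y])) (W w)%:E)%E.
  move=> mF mW W0.
  have mS y : measurable (F @^-1` (f @^-1` [set y])).
    by apply: mpre => //; exact: measurable_sfunP.
  transitivity (\int[P]_w \sum_(y \in range f)
      (y * (\1_(F @^-1` (f @^-1` [set y])) w * W w))%:E)%E.
    apply: eq_integral => w _.
    rewrite fimfunE [RHS]fsumEFin//; congr EFin.
    by rewrite mulr_fsuml; apply: eq_fsbigr => y _; rewrite -mulrA !indicE.
  rewrite ge0_integral_fsum //.
  - apply: eq_fsbigr => y; rewrite inE => -[x _ <-].
    under eq_integral do rewrite EFinM.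
    rewrite ge0_integralZl_EFin //.
    + rewrite [in RHS]integral_mkcond; congr (_ * _)%E; apply: eq_integral => w _.
      by rewrite patchE indicE; case: ifP => _; rewrite ?mul1r ?mul0r.
    + by move=> w _; rewrite lee_fin mulr_ge0.
    + by apply/measurable_EFinP; apply: measurable_funM.
  - move=> y; apply/measurable_EFinP.
    by apply: measurable_funM => //; apply: measurable_funM => //.
  - move=> y w _; rewrite lee_fin indicE.
    have [] := boolP (w \in _); last by rewrite mul0r mulr0.
    by rewrite inE /= => <-; rewrite mul1r mulr_ge0.
have limit_case (F : T -> GT) (W : T -> R) :
    measurable_fun setT F -> measurable_fun setT W -> (forall w, 0 <= W w) ->
    ((\int[P]_w (g n (F w) * W w)%:E)%E @[n --> \oo]
      --> (\int[P]_w (h (F w) * W w)%:E)%E).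
  move=> mF mW W0.
  have -> : (\int[P]_w (h (F w) * W w)%:E =
      \int[P]_w (limn (fun n => (g n (F w) * W w)%:E)))%E.
    apply: eq_integral => w _; apply/esym/cvg_lim => //.
    under eq_fun do rewrite EFinM.
    rewrite EFinM; apply: cvgeZr => //.
    exact: (cvg_nnsfun_approx measurableT mEh h0' Logic.I).
  apply: (@cvg_monotone_convergence _ _ _ P setT measurableT
    (fun n w => (g n (F w) * W w)%:E)) => //.
  - move=> n; apply/measurable_EFinP; apply: measurable_funM => //.
    by apply: measurableT_comp => //.
  - by move=> n w _; rewrite lee_fin mulr_ge0.
  - move=> w _ m n mn; rewrite lee_fin ler_wpM2r//.
    by have /lefP := @nd_nnsfun_approx _ _ _ _ measurableT _ mEh _ _ mn; apply.
have e n : (\int[P]_w (g n (Phi w) * U w)%:E = \int[P]_w (g n (Psi w) * V w)%:E)%E.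
  rewrite !simple_case //; apply: eq_fsbigr => y _; congr (_ * _)%E.
  by apply: transfer_set; exact: measurable_sfunP.
have l1 := limit_case Phi U mPhi mU U0; have l2 := limit_case Psi V mPsi mV V0.
rewrite (eq_cvg _ _ e) in l1.
exact: (cvg_unique (@ereal_hausdorff R) l1 l2).
Qed.

End transfer.

(** * Maurey's empirical method for quadratic forms *)

Section quadratic_forms.
Context {R : realType} {d : nat}.
Implicit Types (S : 'I_d -> 'I_d -> R) (u v w : 'I_d -> R).

Definition bform S u v : R := \sum_(j < d) \sum_(k < d) u j * v k * S j k.
Definition qform S v : R := bform S v v.

Lemma bform_sym S u v : (forall j k, S j k = S k j) -> bform S u v = bform S v u.
Proof.
move=> sS; rewrite /bform exchange_big /=; apply: eq_bigr => j _.
by apply: eq_bigr => k _; rewrite sS [u _ * _]mulrC.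
Qed.

Lemma bformDl S u v w : bform S (fun j => u j + v j) w = bform S u w + bform S v w.
Proof.
rewrite /bform -big_split /=; apply: eq_bigr => j _.
by rewrite -big_split /=; apply: eq_bigr => k _; rewrite !mulrDl.
Qed.

Lemma bformZl S a u v : bform S (fun j => a * u j) v = a * bform S u v.
Proof.
rewrite /bform mulr_sumr; apply: eq_bigr => j _.
by rewrite mulr_sumr; apply: eq_bigr => k _; rewrite !mulrA.
Qed.

Lemma qformZ S a v : qform S (fun j => a * v j) = a ^+ 2 * qform S v.
Proof.
rewrite /qform /bform mulr_sumr; apply: eq_bigr => j _.
by rewrite mulr_sumr; apply: eq_bigr => k _; rewrite expr2; ring.
Qed.

Lemma qformD S u v : (forall j k, S j k = S k j) ->
  qform S (fun j => u j + v j) = qform S u + 2 * bform S u v + qform S v.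
Proof.
move=> sS; rewrite /qform bformDl [bform S u (fun _ => _)]bform_sym // [bform S v (fun _ => _)]bform_sym //.
by rewrite !bformDl [bform S v u]bform_sym //; ring.
Qed.

Lemma qform_lin S S' a b v :
  qform (fun j k => a * S j k + b * S' j k) v = a * qform S v + b * qform S' v.
Proof.
rewrite /qform /bform !mulr_sumr -big_split; apply: eq_bigr => j _.
rewrite !mulr_sumr -big_split; apply: eq_bigr => k _ /=; ring.
Qed.

Lemma qform_id v : qform (fun j k => (j == k)%:R) v = norm2 v ^+ 2.
Proof.
rewrite /norm2 sqr_sqrtr; last by apply: sumr_ge0 => j _; rewrite sqr_ge0.
apply: eq_bigr => j _; rewrite (bigD1 j) //= eqxx mulr1 big1 ?addr0 ?expr2 //.
by move=> k kj; rewrite eq_sym (negbTE kj) mulr0.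
Qed.

Lemma qform_rank1 u v : qform (fun j k => u j * u k) v = dotv u v ^+ 2.
Proof.
rewrite /dotv expr2 mulr_suml; apply: eq_bigr => j _.
by rewrite mulr_sumr; apply: eq_bigr => k _; ring.
Qed.

(** The vertices of the l1 ball. A single ordinal as index set makes words of vertices countable up
    to order. *)
Definition sgn_unit (i : 'I_(d + d)) : 'I_d -> R :=
  match fintype.split i with
  | inl k => fun j => (j == k)%:R
  | inr k => fun j => - (j == k)%:R
  end.

(** An unnormalised Maurey sample. Letters may repeat or cancel, so a word of length m gives an
    integer vector of l1 norm at most m. *)
Definition lattice_pt (t : seq 'I_(d + d)) : 'I_d -> R := fun j => \sum_(i <- t) sgn_unit i j.

Lemma bform_suml S (I : finType) (p : I -> R) (z : I -> 'I_d -> R) w :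
  bform S (fun j => \sum_i p i * z i j) w = \sum_i p i * bform S (z i) w.
Proof.
rewrite /bform; under [RHS]eq_bigr => i _ do rewrite mulr_sumr.
rewrite [RHS]exchange_big /=; apply: eq_bigr => j _.
under [RHS]eq_bigr => i _ do rewrite mulr_sumr.
rewrite [RHS]exchange_big /=; apply: eq_bigr => k _.
by rewrite -mulrA mulr_suml; apply: eq_bigr => i _; ring.
Qed.

(* Averaging over an i.i.d. sample of [m] points [z i] of law [p] without introducing the sample space. *)
Lemma maurey_average S (sS : forall j k, S j k = S k j) (I : finType) (p : I -> R)
    (z : I -> 'I_d -> R) (m : nat) (w zb : 'I_d -> R) :
  (forall i, 0 <= p i) -> \sum_i p i = 1 ->
  (forall t : seq I, size t = m -> 0 <= qform S (fun j => w j + \sum_(i <- t) z i j)) ->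
  zb = (fun j => \sum_i p i * z i j) ->
  0 <= qform S w + (2 * m)%:R * bform S w zb + m%:R * \sum_i p i * qform S (z i)
         + m%:R * (m%:R - 1) * qform S zb.
Proof.
(* The first sampled point joins the shift [w], which is what the statement carries [w] for;
   averaging over that point then gives the next case. *)
move=> p0 p1 H zbE; elim: m w H => [|m IH] w H.
  have := H [::] erefl.
  under [X in qform S X]eq_fun do rewrite big_nil addr0.
  by rewrite muln0 !mul0r !addr0.
have step i : 0 <= p i * (qform S (fun j => w j + z i j)
    + (2 * m)%:R * bform S (fun j => w j + z i j) zb
    + m%:R * \sum_i p i * qform S (z i) + m%:R * (m%:R - 1) * qform S zb).
  apply: mulr_ge0 => //; apply: IH => t st.
  have := H (i :: t); rewrite /= st => /(_ erefl).
  by under [X in qform S X]eq_fun do rewrite big_cons addrA.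
have : 0 <= \sum_i p i * (qform S (fun j => w j + z i j)
    + (2 * m)%:R * bform S (fun j => w j + z i j) zb
    + m%:R * \sum_i p i * qform S (z i) + m%:R * (m%:R - 1) * qform S zb).
  by apply: sumr_ge0 => i _; exact: step.
set Q := \sum_i p i * qform S (z i).
pose C := qform S w + (2 * m)%:R * bform S w zb + m%:R * Q + m%:R * (m%:R - 1) * qform S zb.
have E i : p i * (qform S (fun j => w j + z i j)
    + (2 * m)%:R * bform S (fun j => w j + z i j) zb
    + m%:R * Q + m%:R * (m%:R - 1) * qform S zb)
  = p i * C + 2 * (p i * bform S (z i) w) + p i * qform S (z i)
    + (2 * m)%:R * (p i * bform S (z i) zb).
  by rewrite /C qformD // bformDl [bform S (z i) w]bform_sym //; ring.
rewrite (eq_bigr _ (fun i _ => E i)); have [C' CE] : exists C', C' = C by exists C.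
rewrite -CE.
rewrite !big_split /= -!mulr_sumr -mulr_suml -/Q.
rewrite p1 -!bform_suml -zbE [bform S zb w]bform_sym // -/(qform S zb) CE /C.
rewrite !natrM -[m.+1]addn1 natrD => h; apply: le_trans h _.
by rewrite le_eqVlt; apply/orP; left; apply/eqP; ring.
Qed.

Lemma qform_delta S (k : 'I_d) a : qform S (fun j => a * (j == k)%:R) = a ^+ 2 * S k k.
Proof.
rewrite qformZ; congr (_ * _).
rewrite /qform /bform (bigD1 k) //= [X in _ + X]big1 ?addr0; last first.
  by move=> j jk; rewrite big1 // => l _; rewrite (negbTE jk) !mul0r.
rewrite (bigD1 k) //= eqxx !mul1r big1 ?addr0 // => j jk.
by rewrite (negbTE jk) mulr0 mul0r.
Qed.

Lemma qform_sgn_unit S i : qform S (sgn_unit i) =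
  match fintype.split i with inl k => S k k | inr k => S k k end.
Proof.
rewrite /sgn_unit; case: fintype.split => k.
  by under [X in qform S X]eq_fun do rewrite -[_%:R]mul1r; rewrite qform_delta expr1n mul1r.
by under [X in qform S X]eq_fun do rewrite -mulN1r; rewrite qform_delta sqrrN expr1n mul1r.
Qed.

(* Maurey's empirical method: [v / norm1 v] is the mean of a random signed unit vector. *)
Lemma maurey S (sS : forall j k, S j k = S k j) (m : nat) v : (0 < m)%N ->
  (forall t, size t = m -> 0 <= qform S (lattice_pt t)) ->
  0 <= norm1 v * (\sum_j `|v j| * S j j) + (m%:R - 1) * qform S v.
Proof.
move=> m0 H.
have [v0|v0] := eqVneq (norm1 v) 0.
  have vj j : v j = 0.
    apply/normr0_eq0/eqP; rewrite eq_le normr_ge0 andbT -v0 /norm1 (bigD1 j) //=.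
    by rewrite lerDl sumr_ge0.
  rewrite v0 mul0r add0r /qform /bform big1 ?mulr0 // => j _.
  by rewrite big1 // => k _; rewrite vj !mul0r.
have B0 : 0 < norm1 v by rewrite lt0r v0 /=; apply: sumr_ge0.
set B := norm1 v in v0 B0 *.
(* The positive part of [v k] is put on e_k and the negative part on -e_k, divided by B: the two
   weights add up to |v k| / B and differ by v k / B. *)
pose p (i : 'I_(d + d)) := match fintype.split i with
  | inl k => (`|v k| + v k) / (2 * B) | inr k => (`|v k| - v k) / (2 * B) end.
have splitl (k : 'I_d) : fintype.split (lshift d k) = inl k by exact: (unsplitK (inl k)).
have splitr (k : 'I_d) : fintype.split (rshift d k) = inr k by exact: (unsplitK (inr k)).
have p0 i : 0 <= p i.
  rewrite /p; case: fintype.split => k; apply: divr_ge0.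
  - by have := ler_norm (- v k); rewrite normrN; lra.
  - lra.
  - by rewrite subr_ge0 ler_norm.
  - lra.
have sumsplit (F : 'I_d -> R) (F' : 'I_d -> R) :
   \sum_i p i * (match fintype.split i with inl k => F k | inr k => F' k end)
   = \sum_(k < d) ((`|v k| + v k) * F k + (`|v k| - v k) * F' k) / (2 * B).
  rewrite big_split_ord /= -big_split /=; apply: eq_bigr => k _.
  by rewrite /p splitl splitr; ring.
have p1 : \sum_i p i = 1.
  have := sumsplit (fun=> 1) (fun=> 1).
  under eq_bigr => i _ do (have -> : match fintype.split i with inl _ => 1 | inr _ => 1 end = 1 :> R by case: fintype.split).
  under eq_bigr do rewrite mulr1.
  move=> ->.
  have -> : \sum_(k < d) ((`|v k| + v k) * 1 + (`|v k| - v k) * 1) / (2 * B) = \sum_(k < d) `|v k| * B^-1.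
    by apply: eq_bigr => k _; field.
  by rewrite -mulr_suml -/(norm1 v) -/B divff.
have zb j : \sum_i p i * sgn_unit i j = B^-1 * v j.
  have := sumsplit (fun k => (j == k)%:R) (fun k => - (j == k)%:R).
  have -> : \sum_i p i * match fintype.split i with inl k => (j == k)%:R | inr k => - (j == k)%:R end
     = \sum_i p i * sgn_unit i j.
    by apply: eq_bigr => i _; rewrite /sgn_unit; case: fintype.split.
  move=> ->; rewrite (bigD1 j) //= eqxx big1 ?addr0; last first.
    by move=> k kj; rewrite eq_sym (negbTE kj) oppr0 !mulr0 addr0 mul0r.
  by rewrite mulr1n; field.
have := @maurey_average S sS _ p sgn_unit m (fun=> 0) (fun j => B^-1 * v j) p0 p1.
have -> : \sum_i p i * qform S (sgn_unit i) = B^-1 * \sum_j `|v j| * S j j.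
  under eq_bigr do rewrite qform_sgn_unit.
  by rewrite sumsplit [RHS]mulr_sumr; apply: eq_bigr => k _; field.
have q0 : qform S (fun=> 0) = 0.
  by rewrite /qform /bform big1 // => j _; rewrite big1 // => k _; rewrite !mul0r.
have b0 u : bform S (fun=> 0) u = 0.
  by rewrite /bform big1 // => j _; rewrite big1 // => k _; rewrite !mul0r.
rewrite q0 b0 mulr0 !add0r qformZ => h.
have {}h0 : forall t : seq 'I_(d + d), size t = m ->
   0 <= qform S (fun j => 0 + \sum_(i <- t) sgn_unit i j).
  move=> t st; under [X in qform S X]eq_fun do rewrite add0r; exact: H.
have {h h0} := h h0 (esym (funext zb)) => h.
have : 0 <= B ^+ 2 / m%:R * (m%:R * (B^-1 * \sum_j `|v j| * S j j)
   + m%:R * (m%:R - 1) * (B^-1 ^+ 2 * qform S v)).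
  by apply: mulr_ge0 => //; rewrite divr_ge0 // sqr_ge0.
suff -> : B ^+ 2 / m%:R * (m%:R * (B^-1 * \sum_j `|v j| * S j j)
   + m%:R * (m%:R - 1) * (B^-1 ^+ 2 * qform S v)) =
   B * (\sum_j `|v j| * S j j) + (m%:R - 1) * qform S v by [].
have mn0 : m%:R != 0 :> R by rewrite pnatr_eq0 -lt0n.
by field; rewrite mn0 v0.
Qed.

End quadratic_forms.

(** * Independence and Chernoff bounds *)

Section independence.
Context {dsp : measure_display} {T : measurableType dsp} {R : realType}.
Variable P : probability T R.
Context {T0 : pointedType} (G : set (set T0)).
Notation GT := (g_sigma_algebraType G).
Hypotheses (GI : setI_closed G) (GsetT : G setT).
Context {n : nat} (Phi : 'I_n -> T -> GT).
Hypothesis mPhi : forall i, measurable_fun setT (Phi i).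
Hypothesis indepG : forall B : 'I_n -> set GT, (forall i, G (B i)) ->
  P (\bigcap_i (Phi i @^-1` B i)) = (\prod_(i < n) fine (P (Phi i @^-1` B i)))%:E.

Let mG (i : 'I_n) (B : set GT) : G B -> measurable (Phi i @^-1` B).
Proof.
by move=> GB; rewrite -[X in measurable X]setTI; apply: mPhi => //; exact: sub_sigma_algebra.
Qed.

Let intG (i : 'I_n) (B : set GT) : G B ->
  (\int[P]_w (\1_B (Phi i w))%:E = P (Phi i @^-1` B))%E.
Proof. by move=> GB; have := integral_indic P measurableT (mG i B GB); rewrite setIT => <-. Qed.

(** Indicators are exchanged for arbitrary functions one coordinate at a time. For the coordinate
    being exchanged, the product of the other factors acts as a density; on its generated
    sigma-algebra it agrees with the constant [c], and [transfer_integral] concludes. *)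
Lemma indep_integral_prod (F : 'I_n -> GT -> R) :
  (forall i, measurable_fun setT (F i)) -> (forall i x, 0 <= F i x) ->
  (forall i, (\int[P]_w (F i (Phi i w))%:E < +oo)%E) ->
  (\int[P]_w (\prod_(i < n) F i (Phi i w))%:E
     = (\prod_(i < n) fine (\int[P]_w (F i (Phi i w))%:E))%:E)%E.
Proof.
move=> mF F0 Ffin.
(* The coordinates below [k] are already general, while those from [k] on are still indicators of
   sets of [G]. *)
suff H k : forall F : 'I_n -> GT -> R,
    (forall i, measurable_fun setT (F i)) -> (forall i x, 0 <= F i x) ->
    (forall i, (\int[P]_w (F i (Phi i w))%:E < +oo)%E) ->
    (forall i : 'I_n, (k <= i)%N -> exists2 B : set GT, G B & F i = \1_B) ->
    (\int[P]_w (\prod_(i < n) F i (Phi i w))%:E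
       = (\prod_(i < n) fine (\int[P]_w (F i (Phi i w))%:E))%:E)%E.
  by apply: (H n) => // i; rewrite leqNgt ltn_ord.
elim: k => [|k IH] {mF F0 Ffin}F mF F0 Ffin FB.
  have /choice[B HB] : forall i, exists B : set GT, G B /\ F i = \1_B.
    by move=> i; have [B GB FE] := FB i isT; exists B.
  have intB i : (\int[P]_w (F i (Phi i w))%:E = P (Phi i @^-1` B i))%E.
    by rewrite (HB i).2 intG //; exact: (HB i).1.
  under [in RHS]eq_bigr do rewrite intB.
  rewrite -indepG; last by move=> i; exact: (HB i).1.
  rewrite -[X in _ = P X]setIT -(integral_indic P measurableT); last first.
    by apply: fin_bigcap_measurable => [|i _]; [exact: finite_finset|apply: mG; exact: (HB i).1].
  apply: eq_integral => w _; congr EFin; rewrite indicE.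
  have [|] := boolP (w \in _).
    rewrite inE => Hw; rewrite big1 // => i _; rewrite (HB i).2 indicE.
    by rewrite mem_set //; exact: Hw.
  rewrite notin_setE => /existsNP[i /not_implyP[_ Hi]].
  by rewrite (bigD1 i) //= (HB i).2 indicE memNset // mul0r.
have [kn|nk] := ltnP k n; last first.
  by apply: IH => // i; rewrite leqNgt (leq_trans (ltn_ord i)).
pose k0 := Ordinal kn.
pose U w := \prod_(i < n | i != k0) F i (Phi i w).
pose c := \prod_(i < n | i != k0) fine (\int[P]_w (F i (Phi i w))%:E).
have mFP i : measurable_fun setT (fun w => F i (Phi i w)) by exact: measurableT_comp.
have mU : measurable_fun setT U.
  rewrite /U; under eq_fun do rewrite big_mkcond.
  by apply: measurable_prod => i _; case: (i != k0).
have U0 w : 0 <= U w by apply: prodr_ge0.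
have c0 : 0 <= c by apply: prodr_ge0 => i _; apply: fine_ge0; apply: integral_ge0 => w _; rewrite lee_fin.
have key (B : set GT) : G B -> (\int[P]_(w in Phi k0 @^-1` B) (U w)%:E =
    \int[P]_(w in Phi k0 @^-1` B) c%:E)%E.
  move=> GB.
  have mB := mG k0 B GB.
  have mB' : measurable (B : set GT) by exact: sub_sigma_algebra.
  pose F' i := if i == k0 then \1_B else F i.
  have F'k0 : F' k0 = \1_B by rewrite /F' eqxx.
  have F'n i : i != k0 -> F' i = F i by rewrite /F' => /negbTE ->.
  have int1 := intG k0 B GB.
  have := IH F'.
  rewrite (_ : (fun w => _) = fun w => (\1_(Phi k0 @^-1` B) w * U w)%:E); last first.
    by apply/funext => w; rewrite (bigD1 k0) //= F'k0; congr ((_ * _)%:E); apply: eq_bigr => i /F'n ->.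
  rewrite (bigD1 k0) //= F'k0 int1.
  under [X in (_ * X)%:E]eq_bigr => i ik do rewrite F'n //.
  rewrite -/c => IHF.
  have -> : (\int[P]_(w in Phi k0 @^-1` B) (U w)%:E =
      \int[P]_w (\1_(Phi k0 @^-1` B) w * U w)%:E)%E.
    rewrite integral_mkcond; apply: eq_integral => w _.
    by rewrite patchE indicE; case: ifP => _; rewrite ?mul1r ?mul0r.
  rewrite IHF.
  - by rewrite integral_cst // muleC EFinM fineK // fin_num_measure.
  - by move=> i; rewrite /F'; case: ifP.
  - by move=> i x; rewrite /F'; case: ifP.
  - move=> i; rewrite /F'; case: eqP => [->|_]; last exact: Ffin.
    by rewrite int1; apply: le_lt_trans (probability_le1 P mB) _; rewrite ltry.
  - move=> i ki; rewrite /F'; case: eqP => [_|/eqP ik]; first by exists B.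
    by apply: FB; rewrite ltn_neqAle ki andbT; apply: contra ik => /eqP e; apply/eqP/val_inj.
(* Finiteness of the product is itself a consequence of [key], taken at the full set. *)
have Ufin : (\int[P]_w (U w)%:E < +oo)%E.
  have := key _ GsetT; rewrite !preimage_setT => ->.
  by rewrite integral_cst // [X in (c%:E * X)%E](probability_setT P) mule1 ltry.
have := @transfer_integral _ _ _ P _ G (Phi k0) (Phi k0) U (fun=> c) (mPhi k0) (mPhi k0)
  mU (measurable_cst _) U0 (fun=> c0) Ufin GI GsetT key (F k0) (mF k0) (F0 k0).
rewrite (_ : (fun w => _) = fun w => (\prod_(i < n) F i (Phi i w))%:E); last first.
  by apply/funext => w; rewrite [in RHS](bigD1 k0).
move=> ->; rewrite [in RHS](bigD1 k0) //= -/c.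
under eq_integral do rewrite mulrC EFinM.
rewrite ge0_integralZl_EFin //.
- by rewrite muleC EFinM fineK // ge0_fin_numE ?Ffin //; apply: integral_ge0 => w _; rewrite lee_fin.
- by move=> w _; rewrite lee_fin.
- exact/measurable_EFinP.
Qed.

End independence.

(** * Moment generating functions of sub-exponential variables *)

Section exponential_moments.
Context {dsp : measure_display} {T : measurableType dsp} {R : realType}.
Variable P : probability T R.

(** Tangent lines replace Taylor's remainder: exp x - 1 <= x exp x gives exp x - 1 - x <= x (exp x -
    1), and the last factor is bounded once more, by the same inequality for x >= 0 and by exp x - 1
    >= x for x < 0. *)
Lemma expR_le_quad (x : R) : expR x <= 1 + x + x ^+ 2 * expR `|x|.
Proof.
have h1 : expR x - 1 <= x * expR x.
  have := expR_ge1Dx (- x); have := expRxMexpNx_1 x; have := expR_gt0 x.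
  by move=> e0 e1 e2; have := ler_wpM2l (ltW e0) e2; rewrite e1; lra.
have h2 : x * (expR x - 1) <= x ^+ 2 * expR `|x|.
  have [x0|x0] := leP 0 x.
    by rewrite ger0_norm // expr2 -mulrA ler_wpM2l.
  have := expR_ge1Dx x; have e1 : 1 <= expR `|x|.
    by have := expR_ge1Dx `|x|; have := normr_ge0 x; lra.
  move=> e2; have := sqr_ge0 x => x2.
  have := ler_wpM2l x2 e1; have : x * (expR x - 1) <= x * x.
    by rewrite ler_wnM2l //; [exact: ltW|lra].
  by rewrite expr2; lra.
by lra.
Qed.

Lemma sqr_le_expR (y : R) : 0 <= y -> y ^+ 2 <= 2 * expR y.
Proof. by move=> y0; have := expR_ge1Dxn 1 y0; rewrite (_ : 2`!%:R = 2) //; lra. Qed.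

Variable W : T -> R.
Hypothesis mW : measurable_fun setT W.
Hypothesis W2 : (\int[P]_w (expR `|W w|)%:E <= 2%:E)%E.

Let mexpW : measurable_fun setT (fun w => expR `|W w|).
Proof. by apply: measurableT_comp => //; exact: measurableT_comp. Qed.

Lemma integrable_expR_norm : P.-integrable setT (fun w => (expR `|W w|)%:E).
Proof.
apply/integrableP; split; first exact/measurable_EFinP.
under eq_integral do rewrite gee0_abs ?lee_fin ?expR_ge0 //.
by apply: le_lt_trans W2 _; rewrite ltry.
Qed.

Lemma integrable_of_expR_norm : P.-integrable setT (fun w => (W w)%:E).
Proof.
apply: (le_integrable measurableT _ _ integrable_expR_norm); first exact/measurable_EFinP.
move=> w _; rewrite !abse_EFin lee_fin [leRHS]ger0_norm ?expR_ge0 //.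
by have := expR_ge1Dx `|W w|; lra.
Qed.

(** One half of exp |W| pays for W^2 <= 8 exp(|W| / 2), the other half for exp |t W|; as E exp |W|
    <= 2, the quadratic term is 8 * 2 * t^2. The mean stays in the exponent, so that the moment
    hypothesis need not be carried over to a centred variable. *)
Lemma mgf_bound (t : R) : `|t| <= 4^-1 ->
  (\int[P]_w (expR (t * W w))%:E
    <= (expR (t * fine (\int[P]_w (W w)%:E) + 16 * t ^+ 2))%:E)%E.
Proof.
move=> t4.
have iW := integrable_of_expR_norm; have ie := integrable_expR_norm.
pose m := fine (\int[P]_w (W w)%:E)%E.
have EW : (\int[P]_w (W w)%:E = m%:E)%E by rewrite fineK // integrable_fin_num.
have pw w : expR (t * W w) <= 1 + t * W w + (8 * t ^+ 2) * expR `|W w|.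
  apply: le_trans (expR_le_quad _) _; rewrite lerD2l.
  rewrite exprMn -[leLHS]mulrA (_ : 8 * t ^+ 2 * _ = t ^+ 2 * (8 * expR `|W w|)); last by ring.
  apply: ler_wpM2l; first exact: sqr_ge0.
  have -> : expR `|W w| = expR (`|W w| / 2) * expR (`|W w| / 2) by rewrite -expRD; congr expR; lra.
  have h1 : W w ^+ 2 <= 8 * expR (`|W w| / 2).
    have := @sqr_le_expR (`|W w| / 2); rewrite divr_ge0 // => /(_ isT).
    by rewrite expr_div_n real_normK ?num_real //; lra.
  have h2 : expR `|t * W w| <= expR (`|W w| / 2).
    rewrite ler_expR normrM; have := normr_ge0 (W w); nra.
  by rewrite mulrA; apply: ler_pM => //; rewrite ?sqr_ge0 ?expR_ge0.
have iL : P.-integrable setT (fun w => (1 + t * W w)%:E).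
  apply: (eq_integrable measurableT (fun w => (1%:E + t%:E * (W w)%:E)%E)) => //.
  apply: integrableD => //; last exact: integrableZl.
  exact: finite_measure_integrable_cst.
have iR : P.-integrable setT (fun w => ((8 * t ^+ 2) * expR `|W w|)%:E).
  by apply: (eq_integrable measurableT (fun w => ((8 * t ^+ 2)%:E * (expR `|W w|)%:E)%E)) => //; exact: integrableZl.
apply: (@le_trans _ _ (\int[P]_w ((1 + t * W w)%:E + ((8 * t ^+ 2) * expR `|W w|)%:E))%E).
  apply: ge0_le_integral => //.
  - apply/measurable_EFinP; apply: measurableT_comp => //; exact: measurable_funM.
  - apply/measurable_EFinP; apply: measurable_funD.
      by apply: measurable_funD => //; exact: measurable_funM.
    exact: measurable_funM.
  - by move=> w _; rewrite -EFinD lee_fin.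
rewrite integralD //.
have -> : (\int[P]_w (1 + t * W w)%:E = (1 + t * m)%:E)%E.
  under eq_integral do rewrite EFinD EFinM.
  rewrite integralD //; last 2 first.
  - exact: finite_measure_integrable_cst.
  - exact: integrableZl.
  by rewrite integral_cst // integralZl // EW [X in (_ * X)%E](probability_setT P) mule1 EFinD EFinM.
under eq_integral do rewrite EFinM.
rewrite integralZl //.
apply: (@le_trans _ _ ((1 + t * m)%:E + (8 * t ^+ 2)%:E * 2%:E)%E).
  by apply: leeD2l; apply: lee_wpmul2l => //; rewrite lee_fin mulr_ge0 ?sqr_ge0.
rewrite -EFinM -EFinD lee_fin -/m.
by apply: le_trans (expR_ge1Dx _); lra.
Qed.

End exponential_moments.

(** * A Bernstein-type tail bound for i.i.d. samples *)

Section chernoff_iid.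
Context {dsp : measure_display} {T : measurableType dsp} {R : realType}.
Variable P : probability T R.
Context {T0 : pointedType} (G : set (set T0)).
Notation GT := (g_sigma_algebraType G).
Hypotheses (GI : setI_closed G) (GsetT : G setT).
Context {n : nat} (Phi : 'I_n -> T -> GT) (Phi0 : T -> GT).
Hypothesis mPhi : forall i, measurable_fun setT (Phi i).
Hypothesis mPhi0 : measurable_fun setT Phi0.
Hypothesis indepG : forall B : 'I_n -> set GT, (forall i, G (B i)) ->
  P (\bigcap_i (Phi i @^-1` B i)) = (\prod_(i < n) fine (P (Phi i @^-1` B i)))%:E.
Hypothesis lawG : forall i (B : set GT), G B -> P (Phi i @^-1` B) = P (Phi0 @^-1` B).

Lemma law_integral (i : 'I_n) (h : GT -> R) : measurable_fun setT h -> (forall x, 0 <= h x) ->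
  (\int[P]_w (h (Phi i w))%:E = \int[P]_w (h (Phi0 w))%:E)%E.
Proof.
move=> mh h0.
have mpre (F : T -> GT) (B : set GT) : measurable_fun setT F -> G B -> measurable (F @^-1` B).
  by move=> mF GB; rewrite -[X in measurable X]setTI; apply: mF => //; exact: sub_sigma_algebra.
have fin1 : (\int[P]_(w in setT) 1%:E < +oo)%E.
  by rewrite integral_cst // [X in (_ * X)%E](probability_setT P) mule1 ltry.
have law B : G B -> (\int[P]_(w in Phi i @^-1` B) 1%:E = \int[P]_(w in Phi0 @^-1` B) 1%:E)%E.
  by move=> GB; have m1 := mpre _ _ (mPhi i) GB; have m2 := mpre _ _ mPhi0 GB; rewrite !integral_cst //; congr (_ * _)%E; exact: lawG.
have := @transfer_integral _ _ _ P _ G (Phi i) Phi0 (fun=> 1) (fun=> 1) (mPhi i) mPhi0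
  (measurable_cst _) (measurable_cst _) (fun=> ler01) (fun=> ler01) fin1 GI GsetT law h mh h0.
under eq_integral do rewrite mulr1.
by under [X in _ = X -> _]eq_integral do rewrite mulr1.
Qed.

(** Restricting to tau <= 1 stays in the Gaussian range of Bernstein's inequality, whence an
    exponent quadratic in tau. *)
Lemma chernoff_iid (W : GT -> R) (A tau : R) : measurable_fun setT W ->
  (\int[P]_w (expR `|W (Phi0 w)|)%:E <= 2%:E)%E -> 0 <= tau <= 1 ->
  (P [set w | n%:R * (fine (\int[P]_w (W (Phi0 w))%:E)%E + A * tau) <= \sum_(i < n) W (Phi i w)]%R
    <= (expR (- (n%:R * tau ^+ 2 * (A / 4 - 1))))%:E)%E.
Proof.
move=> mW W2 /andP[tau0 tau1].
set m := fine _.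
(* The optimal exponent is proportional to [tau], and [mgf_bound] asks for [t <= 1 / 4]. *)
pose t := tau / 4.
have mWP i : measurable_fun setT (fun w => W (Phi i w)) by exact: measurableT_comp.
have mWP0 : measurable_fun setT (fun w => W (Phi0 w)) by exact: measurableT_comp.
set S := [set w | _].
have mS : measurable S.
  rewrite /S -[X in measurable X]setTI.
  apply: (@measurable_fun_le _ _ _ setT (fun=> n%:R * (m + A * tau)) (fun w => \sum_(i < n) W (Phi i w))) => //.
  exact: measurable_sum.
have mgf := @mgf_bound _ _ _ P (fun w => W (Phi0 w)) mWP0 W2 t.
have {}mgf := mgf _; rewrite -/m in mgf.
have t4 : `|t| <= 4^-1 by rewrite ger0_norm /t; lra.
have {}mgf := mgf t4.
have mh : measurable_fun setT (fun x : GT => expR (t * W x)).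
  by apply: measurableT_comp => //; exact: measurable_funM.
have Fi i : (\int[P]_w (expR (t * W (Phi i w)))%:E = \int[P]_w (expR (t * W (Phi0 w)))%:E)%E.
  by apply: (@law_integral i (fun x => expR (t * W x))) => // x; rewrite expR_ge0.
have ind := @indep_integral_prod _ _ _ P _ G GI GsetT n Phi mPhi indepG (fun _ x => expR (t * W x))
  (fun _ => mh) (fun _ x => expR_ge0 _).
have {}ind := ind _.
have fin : forall i, (\int[P]_w (expR (t * W (Phi i w)))%:E < +oo)%E.
  by move=> i; rewrite Fi; apply: le_lt_trans mgf _; rewrite ltry.
have {}ind := ind fin.
have I0 : (0 <= \int[P]_w (expR (t * W (Phi0 w)))%:E)%E.
  by apply: integral_ge0 => w _; rewrite lee_fin expR_ge0.
have bound : (\int[P]_w (\prod_(i < n) expR (t * W (Phi i w)))%:E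
   <= (expR (n%:R * (t * m + 16 * t ^+ 2)))%:E)%E.
  rewrite ind lee_fin expRM_natl.
  under eq_bigr do rewrite Fi.
  rewrite prodr_const card_ord; apply: lerXn2r; rewrite ?nnegrE ?expR_ge0 ?fine_ge0 //.
  rewrite -lee_fin fineK // ge0_fin_numE //; apply: le_lt_trans mgf _; exact: ltry.
pose a := t * (n%:R * (m + A * tau)).
have mk : ((expR a)%:E * P S <= \int[P]_w (\prod_(i < n) expR (t * W (Phi i w)))%:E)%E.
  have := integral_indic P measurableT mS; rewrite setIT => <-.
  rewrite -ge0_integralZl_EFin ?expR_ge0 //; last by exact/measurable_EFinP/measurable_indic.
  apply: ge0_le_integral => //.
  - apply/measurable_EFinP; apply: measurable_funM => //.
  - apply/measurable_EFinP; apply: measurable_prod => i _; apply: measurableT_comp => //.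
    exact: measurable_funM.
  move=> w _; rewrite -EFinM lee_fin indicE.
  have [|_] := boolP (w \in S); last first.
    by rewrite mulr0 prodr_ge0 // => i _; exact: expR_ge0.
  rewrite inE /S /= mulr1 => wS; rewrite -expR_sum ler_expR -mulr_sumr ler_wpM2l //.
  by rewrite /t; lra.
have : ((expR a)%:E * P S <= (expR (n%:R * (t * m + 16 * t ^+ 2)))%:E)%E := le_trans mk bound.
rewrite muleC -lee_pdivlMr ?expR_gt0 // => h; apply: le_trans h _.
rewrite -EFinM lee_fin -expRN -expRD ler_expR /a /t.
by rewrite le_eqVlt; apply/orP; left; apply/eqP; field.
Qed.

End chernoff_iid.

(** * Restricted eigenvalues *)

Section counting.
Context {R : realType}.

(* Keep one term of the binomial expansion of [(1 + x) ^ N <= expR (x * N)]. *)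
Lemma bin_le_expR (N k : nat) (x : R) : 0 < x -> 'C(N, k)%:R * x ^+ k <= expR (x * N%:R).
Proof.
move=> x0; have [kN|Nk] := leqP k N; last by rewrite bin_small // mul0r expR_ge0.
apply: (@le_trans _ _ ((1 + x) ^+ N)).
  rewrite exprDn (bigD1 (Ordinal (kN : (k < N.+1)%N))) //= expr1n mul1r mulr_natl lerDl.
  by apply: sumr_ge0 => i _; rewrite expr1n mul1r mulrn_wge0 // exprn_ge0 // ltW.
by rewrite expRM_natr lerXn2r ?nnegrE ?expR_ge0 ?expR_ge1Dx //; lra.
Qed.

Lemma sparse_entropy_ge1 (d s : nat) : (1 <= s <= d)%N ->
  1 <= (s%:R * ln (expR 1 * d%:R / s%:R) : R).
Proof.
move=> /andP[s1 sd].
have s0 : 0 < s%:R :> R by rewrite ltr0n.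
have s1' : 1 <= s%:R :> R by rewrite ler1n.
have h : 1 <= d%:R / s%:R :> R by rewrite ler_pdivlMr // mul1r ler_nat.
rewrite -mulrA lnM ?posrE ?expR_gt0 //; last by apply: lt_le_trans h.
by rewrite expRK; have := ln_ge0 h; nra.
Qed.

Lemma ln_le_sparse_entropy (d s : nat) : (1 <= s <= d)%N ->
  ln d%:R <= (s%:R * ln (expR 1 * d%:R / s%:R) : R).
Proof.
move=> /andP[s1 sd].
have s0 : 0 < s%:R :> R by rewrite ltr0n.
have s1' : 1 <= s%:R :> R by rewrite ler1n.
have h : 1 <= d%:R / s%:R :> R by rewrite ler_pdivlMr // mul1r ler_nat.
have h0 : 0 < d%:R / s%:R :> R by apply: lt_le_trans h.
rewrite -mulrA lnM ?posrE ?expR_gt0 // expRK.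
rewrite -[d%:R in leLHS](divfK (lt0r_neq0 s0)) [ln (_ * s%:R)]lnM ?posrE //.
have sm1 : 0 <= s%:R - 1 :> R by lra.
by have := mulr_ge0 (ln_ge0 h) sm1; have := ln_sublinear s0; lra.
Qed.

(** The binomial counts the multisets of s + 1 letters among 2d. Taking x = s / d in [bin_le_expR]
    gives the exponent s^2 / d + 2s + (s + 1) log(d / s), at most 3 s (1 + log(d / s)). *)
Lemma bin_le_sparse_entropy (d s : nat) : (1 <= s <= d)%N ->
  'C(s + d + d, s.+1)%:R <= expR (3 * (s%:R * ln (expR 1 * d%:R / s%:R))) :> R.
Proof.
move=> /andP[s1 sd].
have s0 : 0 < s%:R :> R by rewrite ltr0n.
have s1' : 1 <= s%:R :> R by rewrite ler1n.
have sd' : s%:R <= d%:R :> R by rewrite ler_nat.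
have d0 : 0 < d%:R :> R by apply: lt_le_trans sd'.
have h : 1 <= d%:R / s%:R :> R by rewrite ler_pdivlMr // mul1r.
have h0 : 0 < d%:R / s%:R :> R by apply: lt_le_trans h.
have x0 : 0 < s%:R / d%:R :> R by rewrite divr_gt0.
have := @bin_le_expR (s + d + d) s.+1 _ x0.
rewrite -ler_pdivlMr ?exprn_gt0 // => /le_trans; apply.
pose l := ln (d%:R / s%:R : R).
have e : d%:R / s%:R = expR l by rewrite lnK.
rewrite -exprVn invf_div e -expRM_natl -expRD ler_expR.
rewrite -[expR 1 * _ / _]mulrA e -expRD expRK !natrD -addn1 natrD.
have -> : s%:R / d%:R * (s%:R + d%:R + d%:R) = s%:R * (s%:R / d%:R) + 2 * s%:R :> R.
  by field; rewrite lt0r_neq0.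
have x1 : s%:R / d%:R <= 1 :> R by rewrite ler_pdivrMr // mul1r.
have l0 : 0 <= l := ln_ge0 h.
by move: (s%:R / d%:R) (l) x0 x1 l0 => x l' x0 x1 l0; nra.
Qed.

End counting.

Section lattice_sparsity.
Context {R : realType} {d : nat}.

Lemma norm0_lattice_pt (t : seq 'I_(d + d)) : (norm0 (lattice_pt t : 'I_d -> R) <= size t)%N.
Proof.
pose f (i : 'I_(d + d)) : 'I_d := match fintype.split i with inl k => k | inr k => k end.
rewrite /norm0 -(size_map f); apply: leq_trans (card_size (map f t)).
apply: subset_leq_card; apply/fintype.subsetP => j; rewrite inE; apply: contraR => jt.
apply/eqP; rewrite /lattice_pt big_seq big1 // => i it.
have ij : j != f i by apply: contra jt => /eqP ->; exact: map_f.
by move: ij; rewrite /sgn_unit /f; case: fintype.split => k /negbTE -> /=; rewrite ?oppr0.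
Qed.

Lemma perm_lattice_pt (t u : seq 'I_(d + d)) : perm_eq t u ->
  lattice_pt t = lattice_pt u :> ('I_d -> R).
Proof. by move=> tu; apply/funext => j; exact: perm_big. Qed.

End lattice_sparsity.

(** * From sparse integer vectors to arbitrary vectors *)

Section restricted_eigenvalue_transfer.
Context {R : realType} {d : nat}.
Implicit Types (v z : 'I_d -> R).

(** Jensen's inequality for a convex quadratic form at the mean v / |v|_1 of signed unit vectors. It
    is proved pair by pair, testing positivity at e_j - sg e_k with sg the sign of v_j v_k. *)
Lemma qform_le_diag (S : 'I_d -> 'I_d -> R) v : (forall j k, S j k = S k j) ->
  (forall z, 0 <= qform S z) ->
  qform S v <= norm1 v * \sum_j `|v j| * S j j.
Proof.
move=> sS psd.
have pair j k : v j * v k * S j k <= `|v j| * `|v k| * (S j j + S k k) / 2.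
  have delta (a b : R) : 0 <= a ^+ 2 * S j j + b ^+ 2 * S k k + 2 * (a * b * S j k).
    have := psd (fun l => a * (l == j)%:R + b * (l == k)%:R).
    rewrite qformD // !qform_delta; suff -> : bform S (fun l => a * (l == j)%:R) (fun l => b * (l == k)%:R) = a * b * S j k by lra.
    rewrite bformZl bform_sym // bformZl /bform (bigD1 k) //= (bigD1 j) //= !eqxx.
    rewrite [X in _ + X + _]big1 ?[X in _ + X]big1; first by rewrite [S k j]sS mulr1n; ring.
    - by move=> l lk; rewrite big1 // => l' _; rewrite (negbTE lk) !mul0r.
    - by move=> l lj; rewrite (negbTE lj) mulr0 mul0r.
  have [sg e] : exists sg : R, sg ^+ 2 = 1 /\ v j * v k = sg * (`|v j| * `|v k|).
    rewrite -normrM; have [h|h] := leP 0 (v j * v k).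
      by exists 1; rewrite expr1n mul1r ger0_norm.
    by exists (-1); rewrite sqrrN expr1n mulN1r ltr0_norm // opprK.
  have := delta 1 (- sg); rewrite sqrrN e.1 expr1n e.2 => h.
  have n0 : 0 <= `|v j| * `|v k| by rewrite mulr_ge0.
  have := mulr_ge0 n0 h.
  lra.
apply: (@le_trans _ _ (\sum_j \sum_k `|v j| * `|v k| * (S j j + S k k) / 2)).
  by apply: ler_sum => j _; apply: ler_sum => k _; exact: pair.
rewrite le_eqVlt; apply/orP; left; apply/eqP.
transitivity (\sum_j \sum_k (`|v j| * `|v k| * S k k) / 2 + \sum_j \sum_k (`|v k| * `|v j| * S j j) / 2).
  by rewrite -big_split; apply: eq_bigr => j _; rewrite -big_split; apply: eq_bigr => k _ /=; lra.
rewrite [X in _ + X]exchange_big -big_split /= /norm1 mulr_suml; apply: eq_bigr => j _.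
rewrite -big_split mulr_sumr; apply: eq_bigr => k _ /=; lra.
Qed.

Variables (Sig SigR Shat : 'I_d -> 'I_d -> R) (s : nat) (phi eta : R).
Hypotheses (sSig : forall j k, Sig j k = Sig k j) (sSigR : forall j k, SigR j k = SigR k j)
  (sShat : forall j k, Shat j k = Shat k j).
Hypotheses (s1 : (1 <= s)%N) (phi0 : 0 <= phi) (eta0 : 0 <= eta).
Hypothesis psd : forall z, 0 <= qform Sig z.
Hypothesis sparse : forall z, (norm0 z <= s)%N -> qform Sig z <= phi * norm2 z ^+ 2.

Let diag_le j : Sig j j <= phi.
Proof.
have nj : norm2 (fun l => 1 * (l == j)%:R : R) ^+ 2 = 1.
  by rewrite -qform_id (qform_delta (fun j k => (j == k)%:R)) eqxx expr1n mulr1.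
have := sparse (fun l => 1 * (l == j)%:R).
rewrite nj qform_delta expr1n mul1r mulr1; apply.
rewrite /norm0 (leq_trans _ s1) // -(card1 j); apply: subset_leq_card.
by apply/fintype.subsetP => k; rewrite !inE mul1r; case: (k == j) => //; rewrite mulr0n eqxx.
Qed.

(** Words of length s are s-sparse, so phi I - Sigma is nonnegative on them and Maurey's method
    applies. It yields s - 1 copies of v^T Sigma v plus a diagonal sum; [qform_le_diag] trades that
    sum for the missing copy, which also covers s = 1. *)
Lemma qform_le_sparse v : qform Sig v <= phi * (norm2 v ^+ 2 + norm1 v ^+ 2 / s%:R).
Proof.
pose S j k := phi * (j == k)%:R + (-1) * Sig j k.
have sS j k : S j k = S k j by rewrite /S sSig eq_sym.
have := @maurey _ _ S sS s v s1.
have SE z : qform S z = phi * norm2 z ^+ 2 + (-1) * qform Sig z by rewrite /S qform_lin qform_id.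
have H t : size t = s -> 0 <= qform S (lattice_pt t).
  move=> st; rewrite SE mulN1r subr_ge0; apply: sparse.
  by rewrite -st norm0_lattice_pt.
move=> /(_ H); rewrite SE.
have -> : \sum_j `|v j| * S j j = phi * norm1 v - \sum_j `|v j| * Sig j j.
  rewrite /norm1 mulr_sumr -sumrB; apply: eq_bigr => j _; rewrite /S eqxx mulr1n; ring.
have := qform_le_diag Sig v sSig psd.
set B := norm1 v; set q := qform Sig v; set D := \sum_j _; set N := norm2 v ^+ 2 => h1 h2.
have s0 : 0 < s%:R :> R by rewrite ltr0n.
have N0 : 0 <= N by exact: sqr_ge0.
have hs : s%:R * q <= phi * (B ^+ 2 + s%:R * N).
  have := mulr_ge0 phi0 N0; rewrite expr2; lra.
rewrite -(ler_pM2l s0); apply: le_trans hs _.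
by rewrite le_eqVlt; apply/orP; left; apply/eqP; field; rewrite lt0r_neq0.
Qed.

Hypothesis lower : forall t, size t = s.+1 ->
  qform SigR (lattice_pt t) - eta * qform Sig (lattice_pt t) <= qform Shat (lattice_pt t).
Hypothesis upper : forall j, Shat j j <= SigR j j + eta * phi.

(** Maurey's method for Shat - SigR + eta Sig with words of length s + 1, so that the factor m - 1
    is exactly s. The diagonal entries are at most 2 eta phi and [qform_le_sparse] adds one more
    |v|_1^2 / s, which makes the 3. *)
Lemma qform_empirical_ge v :
  qform SigR v - eta * phi * (norm2 v ^+ 2 + 3 * norm1 v ^+ 2 / s%:R) <= qform Shat v.
Proof.
pose S j k := 1 * Shat j k + 1 * ((-1) * SigR j k + eta * Sig j k).
have sS j k : S j k = S k j by rewrite /S sSig sSigR sShat.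
have SE z : qform S z = qform Shat z - qform SigR z + eta * qform Sig z.
  by rewrite /S qform_lin (qform_lin SigR Sig); ring.
have := @maurey _ _ S sS s.+1 v isT.
have H t : size t = s.+1 -> 0 <= qform S (lattice_pt t).
  by move=> st; rewrite SE; have := lower _ st; lra.
move=> /(_ H); rewrite SE.
have B0 : 0 <= norm1 v by apply: sumr_ge0.
have D : \sum_j `|v j| * S j j <= 2 * eta * phi * norm1 v.
  rewrite /norm1 mulr_sumr; apply: ler_sum => j _; rewrite mulrC ler_wpM2r //.
  by have := upper j; have := ler_wpM2l eta0 (diag_le j); rewrite /S; lra.
have := ler_wpM2l B0 D; have := ler_wpM2l eta0 (qform_le_sparse v).
rewrite -[s.+1]addn1 natrD addrK.
set B := norm1 v in B0 D *; set q := qform Sig v; set qR := qform SigR v; set qh := qform Shat v.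
set N := norm2 v ^+ 2; set DS := \sum_j _ => h1 h2 h3.
have s0 : 0 < s%:R :> R by rewrite ltr0n.
have := ler_wpM2l (ltW s0) h1.
have -> : s%:R * (eta * (phi * (N + B ^+ 2 / s%:R))) = eta * phi * (s%:R * N + B ^+ 2).
  by field; rewrite lt0r_neq0.
have e : s%:R * (qR - eta * phi * (N + 3 * B ^+ 2 / s%:R)) = s%:R * qR - eta * phi * (s%:R * N + 3 * B ^+ 2).
  by field; rewrite lt0r_neq0.
by move=> h4; rewrite -(ler_pM2l s0) e; move: h2 h3 h4; rewrite expr2; lra.
Qed.

End restricted_eigenvalue_transfer.

(** * The deterministic Lasso bound *)

Section lasso.
Context {R : realType} {d : nat}.
Implicit Types v : 'I_d -> R.

Lemma sum_supp_le_norm2 (beta v : 'I_d -> R) :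
  \sum_(j | supp beta j) `|v j| <= Num.sqrt (norm0 beta)%:R * norm2 v.
Proof.
set A := \sum_(j | _) _.
have A0 : 0 <= A by apply: sumr_ge0.
have N0 : 0 <= \sum_j v j ^+ 2 by apply: sumr_ge0 => j _; exact: sqr_ge0.
rewrite /norm2 -sqrtrM ?ler0n // -[A]ger0_norm // -sqrtr_sqr.
rewrite ler_sqrt ?mulr_ge0 //.
have cs : \sum_(j | supp beta j) (1 : R) = (norm0 beta)%:R.
  by rewrite sumr_const; congr (_%:R); apply: eq_card => j; rewrite !inE.
have [s0|s0] := eqVneq (norm0 beta) 0%N.
  have -> : A = 0.
    rewrite /A big_pred0 // => j; have := card0_eq s0 j; by rewrite !inE.
  by rewrite expr0n mulr_ge0.
have sp : 0 < (norm0 beta)%:R :> R by rewrite ltr0n lt0n.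
set s := (norm0 beta)%:R in cs sp *.
(* Cauchy-Schwarz as the nonnegativity of the variance of |v_j| over the support. *)
have h : 0 <= \sum_(j | supp beta j) (`|v j| - A / s) ^+ 2.
  by apply: sumr_ge0 => j _; exact: sqr_ge0.
have e : \sum_(j | supp beta j) (`|v j| - A / s) ^+ 2 =
   \sum_(j | supp beta j) v j ^+ 2 - A ^+ 2 / s.
  have e m : \sum_(j | supp beta j) (`|v j| - m) ^+ 2 = \sum_(j | supp beta j) v j ^+ 2
      - (2 * m) * (\sum_(j | supp beta j) `|v j|) + m ^+ 2 * \sum_(j | supp beta j) 1.
    rewrite !mulr_sumr -sumrB -big_split; apply: eq_bigr => j _ /=.
    by rewrite -[v j ^+ 2]real_normK ?num_real //; ring.
  by rewrite e cs -/A; field; rewrite gt_eqF.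
have le : \sum_(j | supp beta j) v j ^+ 2 <= \sum_j v j ^+ 2.
  rewrite [leRHS](bigID (supp beta)) /= lerDl; apply: sumr_ge0 => j _; exact: sqr_ge0.
rewrite -ler_pdivrMl // mulrC; move: h; rewrite e; lra.
Qed.

Lemma cone1_norm1 (beta v : 'I_d -> R) : cone1 (supp beta) 3 v ->
  norm1 v <= 4 * \sum_(j | supp beta j) `|v j|.
Proof. by rewrite /cone1 /norm1 => h; rewrite (bigID (supp beta)) /=; lra. Qed.

Lemma dotv_le_norminf (u v : 'I_d -> R) : `|dotv u v| <= norminf u * norm1 v.
Proof.
rewrite /dotv /norm1 mulr_sumr; apply: le_trans (ler_norm_sum _ _ _) _.
apply: ler_sum => j _; rewrite normrM ler_wpM2r // /norminf.
exact: (le_bigmax _ (fun j => `|u j|)).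
Qed.

Context {dsp : measure_display} {T : measurableType dsp} {n : nat}.
Variables (Ys Rs : 'I_n -> T -> R) (Xs : 'I_n -> 'I_d -> T -> R) (lam : R) (w : T).
Variables (beta0 b : 'I_d -> R) (c : R).

Definition empirical_gram (j k : 'I_d) : R := n%:R^-1 * \sum_(i < n) Rs i w * (Xs i j w * Xs i k w).

Lemma qform_empirical_gram v :
  qform empirical_gram v = n%:R^-1 * \sum_(i < n) Rs i w * dotv (at_ (Xs i) w) v ^+ 2.
Proof.
under [in RHS]eq_bigr do rewrite -qform_rank1.
rewrite /qform /bform mulr_sumr.
under [RHS]eq_bigr do rewrite !mulr_sumr.
rewrite [RHS]exchange_big /=; apply: eq_bigr => j _.
under [RHS]eq_bigr do rewrite !mulr_sumr.
rewrite [RHS]exchange_big /=; apply: eq_bigr => k _.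
rewrite /empirical_gram mulrA mulr_sumr; apply: eq_bigr => i _ /=; rewrite /at_; ring.
Qed.

Let eps i := Ys i w - dotv (at_ (Xs i) w) beta0.

Hypotheses (n0 : (0 < n)%N) (lam0 : 0 < lam) (c0 : 0 < c).
Hypothesis Rs01 : forall i, Rs i w = 0 \/ Rs i w = 1.
Hypothesis lam_noise : 4 / n%:R * norminf (fun j => \sum_(i < n) Rs i w * Xs i j w * eps i) <= lam.
Hypothesis blasso : is_lasso Ys Rs Xs lam w b.
Hypothesis RE : forall v, cone1 (supp beta0) 3 v -> c * norm2 v ^+ 2 <= qform empirical_gram v.

(** The loss carries no factor 1/2, so the noise enters as (2 / n) times an inner product and
    [lam_noise] bounds it by lam / 2 times the l1 error. This leaves weight 3/2 on the support
    against -1/2 off it: their ratio is the aperture 3 of the cone, and 3/2 is the constant of the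
    bound. *)
Lemma lasso_error_bound :
  norm2 (fun j => b j - beta0 j) <= 3 / 2 * Num.sqrt (norm0 beta0)%:R * lam / c.
Proof.
set D := fun j => _.
pose S := supp beta0.
have np : 0 < n%:R :> R by rewrite ltr0n.
have dotD i : dotv (at_ (Xs i) w) b = dotv (at_ (Xs i) w) beta0 + dotv (at_ (Xs i) w) D.
  by rewrite /dotv -big_split; apply: eq_bigr => j _ /=; rewrite /D; ring.
have basic : qform empirical_gram D <=
    2 / n%:R * dotv (fun j => \sum_(i < n) Rs i w * Xs i j w * eps i) D
    + lam * (norm1 beta0 - norm1 b).
  have := blasso beta0; rewrite /lasso_obj qform_empirical_gram.
  have -> : dotv (fun j => \sum_(i < n) Rs i w * Xs i j w * eps i) D =
     \sum_(i < n) Rs i w * eps i * dotv (at_ (Xs i) w) D.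
    rewrite /dotv; under eq_bigr do rewrite mulr_suml.
    rewrite exchange_big /=; apply: eq_bigr => i _; rewrite mulr_sumr.
    by apply: eq_bigr => j _; rewrite /at_; ring.
  have -> : \sum_(i < n) Rs i w * (Ys i w - dotv (at_ (Xs i) w) b) ^+ 2 =
     \sum_(i < n) Rs i w * (Ys i w - dotv (at_ (Xs i) w) beta0) ^+ 2
     - 2 * (\sum_(i < n) Rs i w * eps i * dotv (at_ (Xs i) w) D)
     + \sum_(i < n) Rs i w * dotv (at_ (Xs i) w) D ^+ 2.
    rewrite mulr_sumr -sumrB -big_split; apply: eq_bigr => i _ /=.
    by rewrite dotD /eps; ring.
  set a1 := \sum_(i < n) _; set a2 := \sum_(i < n) _; set a3 := \sum_(i < n) _.
  by move=> h; move: h; lra.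
have l1 : norm1 beta0 - norm1 b <= \sum_(j | S j) `|D j| - \sum_(j | ~~ S j) `|D j|.
  rewrite /norm1 -sumrB (bigID S) /=; apply: lerD.
    apply: ler_sum => j _; rewrite lerBlDr /D.
    have := ler_normD (beta0 j - b j) (b j); rewrite subrK => h; apply: le_trans h _.
    by rewrite lerD2r distrC.
  rewrite -sumrN; apply: ler_sum => j; rewrite /S /supp /= negbK => /eqP bj.
  by rewrite /D bj normr0 sub0r subr0.
have noise : 2 / n%:R * dotv (fun j => \sum_(i < n) Rs i w * Xs i j w * eps i) D <= lam / 2 * norm1 D.
  have h1 := le_trans (ler_norm _) (dotv_le_norminf (fun j => \sum_(i < n) Rs i w * Xs i j w * eps i) D).
  have D0 : 0 <= norm1 D by apply: sumr_ge0.
  have n2 : 0 <= 2 / n%:R :> R by rewrite divr_ge0.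
  have := ler_wpM2l n2 h1; have := ler_wpM2r D0 lam_noise.
  set u := norminf _; set dd := dotv _ _; move=> h2 h3; lra.
have D1 : norm1 D = \sum_(j | S j) `|D j| + \sum_(j | ~~ S j) `|D j|.
  by rewrite /norm1 (bigID S).
have q0 : 0 <= qform empirical_gram D.
  rewrite qform_empirical_gram mulr_ge0 ?invr_ge0 //; apply: sumr_ge0 => i _.
  by rewrite mulr_ge0 ?sqr_ge0 //; case: (Rs01 i) => ->.
have l1' := ler_wpM2l (ltW lam0) l1.
set a := \sum_(j | S j) _ in l1 l1' D1; set a' := \sum_(j | ~~ S j) _ in l1 l1' D1.
have up : qform empirical_gram D <= 3 / 2 * lam * a - lam / 2 * a'.
  by rewrite D1 in noise; lra.
have cone : cone1 (supp beta0) 3 D.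
  rewrite /cone1 -/S -/a -/a' -(ler_pM2l lam0); lra.
have a0 : 0 <= lam * a' by apply: mulr_ge0; [exact: ltW|apply: sumr_ge0].
have h1 := RE _ cone; have h2 := sum_supp_le_norm2 beta0 D; rewrite -/S -/a in h2.
have N0 : 0 <= norm2 D by exact: sqrtr_ge0.
rewrite ler_pdivlMr //.
have [->|Nn] := eqVneq (norm2 D) 0.
  by rewrite mul0r !mulr_ge0 // ?sqrtr_ge0 // ltW.
have Np : 0 < norm2 D by rewrite lt0r Nn.
rewrite -(ler_pM2r Np).
have := ler_wpM2l (ltW lam0) h2; rewrite expr2 in h1; lra.
Qed.

End lasso.

(** * Data missing at random *)

Section conditional_mean.
Context {dsp : measure_display} {T : measurableType dsp} {R : realType}.
Variable P : probability T R.

Lemma measurable_gen {T0 : pointedType} (G : set (set T0)) (Phi : T -> g_sigma_algebraType G) :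
  (forall B, G B -> measurable (Phi @^-1` B)) -> measurable_fun setT Phi.
Proof.
move=> H; apply: (@measurability _ _ T (g_sigma_algebraType G) setT Phi G) => //.
by move=> _ [B GB <-]; rewrite setTI; exact: H.
Qed.

Context {d : nat} (X : 'I_d -> T -> R).
Hypothesis mX : forall j, measurable_fun setT (X j).
Notation SX := (g_sigma_algebraType (cylX X)).

Lemma cylX_setI : setI_closed (cylX X).
Proof.
move=> _ _ [C mC <-] [C' mC' <-]; exists (fun j => C j `&` C' j).
  by move=> j; apply: measurableI.
by apply/seteqP; split=> w /=; [move=> h; split=> j; case: (h j)|move=> [h h'] j; split].
Qed.

Lemma cylX_setT : cylX X setT.
Proof. by exists (fun=> setT) => //; apply/seteqP; split. Qed.

Lemma cylX_measurable D : cylX X D -> measurable D.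
Proof.
move=> [C mC <-].
rewrite (_ : [set w | _] = \bigcap_j (X j @^-1` C j)); last first.
  by apply/seteqP; split=> w h j; [move=> _; exact: h|exact: h].
apply: fin_bigcap_measurable => [|j _]; first exact: finite_finset.
by rewrite -[X in measurable X]setTI; exact: mX.
Qed.

Lemma sigmaX_sub_measurable D : sigmaX X D -> measurable D.
Proof.
by apply: smallest_sub; [exact: sigma_algebra_measurable|exact: cylX_measurable].
Qed.

(** [SX] has the same points as [T] but the sigma-algebra of X; taking the identity as both maps,
    [transfer_integral] compares densities on sigma(X). *)
Lemma measurable_id_SX : measurable_fun setT (idfun : T -> SX).
Proof. by apply: measurable_gen => B; exact: cylX_measurable. Qed.

Lemma measurable_X_SX j : measurable_fun setT (X j : SX -> R).
Proof.
move=> _ B mB; rewrite setTI; apply: sub_sigma_algebra.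
exists (fun k => if k == j then B else setT); first by move=> k; case: ifP.
apply/seteqP; split=> w /=; first by move/(_ j); rewrite eqxx.
by move=> h k; case: eqP => [->|].
Qed.

Lemma sigmaX_measurable_SX g : sigmaX_measurable X g -> measurable_fun setT (g : SX -> R).
Proof. by move=> h _ B mB; rewrite setTI; exact: h. Qed.

Lemma measurable_of_SX (g : T -> R) : measurable_fun setT (g : SX -> R) -> measurable_fun setT g.
Proof. by move=> mg; apply: (measurableT_comp mg measurable_id_SX). Qed.

(** The event g < 0 belongs to sigma(X), and on it the integral of |g| is minus that of Z, hence
    zero. *)
Lemma cond_exp_version_ge0 (Z g : T -> R) : (forall w, 0 <= Z w) ->
  cond_exp_version P X Z g -> {ae P, forall w, 0 <= g w}.
Proof.
move=> Z0 [iZ sg ig H].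
have mg := sigmaX_measurable_SX _ sg; have mg' := measurable_of_SX _ mg.
pose D := [set w | g w < 0].
have sD : sigmaX X D.
  have -> : D = g @^-1` [set` `]-oo, (0 : R)[] by apply/seteqP; split=> w; rewrite /= in_itv.
  by apply: sg; exact: measurable_itv.
have mD := sigmaX_sub_measurable _ sD.
have igD : P.-integrable D (EFin \o g) by apply: integrableS ig.
have abs0 : (\int[P]_(w in D) `|(g w)%:E| = 0)%E.
  apply/eqP; rewrite eq_le integral_ge0 // andbT.
  rewrite (_ : \int[P]_(w in D) _ = \int[P]_(w in D) - (g w)%:E)%E; last first.
    by apply: eq_integral => w; rewrite inE /D /= => gw; rewrite ltr0_norm.
  rewrite integralN /=; last by apply: fin_num_adde_defl; rewrite fin_numN; exact: (integrable_neg_fin_num _ igD).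
  rewrite -H // oppe_le0; apply: integral_ge0 => w _; by rewrite lee_fin.
have := (ae_eq_integral_abs P mD (measurable_int P igD)).1 abs0.
apply: filterS => w /= h; rewrite leNgt; apply/negP => gw.
by have := h gw; case=> g0; rewrite g0 ltxx in gw.
Qed.

(** [transfer_integral] takes densities that are nonnegative everywhere, while a version is so only
    almost surely. *)
Lemma cond_exp_version_pos (Z g : T -> R) : (forall w, 0 <= Z w) ->
  cond_exp_version P X Z g -> cond_exp_version P X Z (fun w => Num.max (g w) 0).
Proof.
move=> Z0 cg; have g0 := cond_exp_version_ge0 _ _ Z0 cg; case: cg => iZ sg ig H.
have mg := sigmaX_measurable_SX _ sg; have mg' := measurable_of_SX _ mg.
have mmax : measurable_fun setT ((fun w => Num.max (g w) 0) : SX -> R).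
  exact: measurable_maxr.
have mmax' := measurable_of_SX _ mmax.
split => //.
- by move=> B mB; have := mmax measurableT B mB; rewrite setTI.
- apply: (le_integrable measurableT _ _ ig); first exact/measurable_EFinP.
  move=> w _ /=; rewrite lee_fin ler_norml.
  by have := ler_norm (g w); have := normr_ge0 (g w); case: (leP (g w) 0) => h; lra.
- move=> D sD; rewrite H //; have mD := sigmaX_sub_measurable _ sD.
  apply: ae_eq_integral => //.
  + by apply/measurable_EFinP; exact: measurable_funTS.
  + by apply/measurable_EFinP; exact: measurable_funTS.
  + by apply: filterS g0 => w gw _; congr EFin; rewrite max_l.
Qed.

Lemma cond_exp_version_unique (Z g g' : T -> R) :
  cond_exp_version P X Z g -> cond_exp_version P X Z g' -> {ae P, forall w, g w = g' w}.
Proof.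
suff le (g1 g2 : T -> R) : cond_exp_version P X Z g1 -> cond_exp_version P X Z g2 ->
    {ae P, forall w, g1 w <= g2 w}.
  move=> cg cg'; have := le _ _ cg cg'; have := le _ _ cg' cg.
  by apply: filterS2 => w h1 h2; apply/eqP; rewrite eq_le h1 h2.
move=> [iZ s1 i1 H1] [_ s2 i2 H2].
have m1 := sigmaX_measurable_SX _ s1; have m2 := sigmaX_measurable_SX _ s2.
have m21 : measurable_fun setT ((fun w => g2 w - g1 w) : SX -> R) by exact: measurable_funB.
have : cond_exp_version P X (fun=> 0) (fun w => g2 w - g1 w).
  split.
  - exact: integrable0.
  - by move=> B mB; have := m21 measurableT B mB; rewrite setTI.
  - by apply: (eq_integrable measurableT (fun w => (g2 w)%:E - (g1 w)%:E)%E) => //; exact: integrableB.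
  - move=> D sD; have mD := sigmaX_sub_measurable _ sD.
    rewrite integral0; under eq_integral do rewrite EFinB.
    have i1D : P.-integrable D (EFin \o g1) by exact: (integrableS measurableT mD _ i1).
    have i2D : P.-integrable D (EFin \o g2) by exact: (integrableS measurableT mD _ i2).
    rewrite (integralB mD i2D i1D).
    by rewrite -H1 // -H2 // subee // integrable_fin_num //; exact: (integrableS measurableT mD _ iZ).
move=> /cond_exp_version_ge0 => /(_ (fun=> lexx 0)).
by apply: filterS => w; rewrite subr_ge0.
Qed.

(** * Replacing the missingness indicator by the propensity score *)

Section missingness.
Variables (Rv Y : T -> R).
Hypotheses (mR : measurable_fun setT Rv) (mY : measurable_fun setT Y).
Hypothesis R01 : forall w, Rv w = 0 \/ Rv w = 1.
Hypothesis ci : cond_indep_given P X Rv Y.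

(** A pi-system generating sigma(X, Y), made of the sets on which conditional independence can be
    read off. *)
Definition genXY : set (set T) :=
  [set D | exists D' B, [/\ sigmaX X D', measurable B & D = D' `&` Y @^-1` B]].

Lemma genXY_setI : setI_closed genXY.
Proof.
move=> _ _ [D [B [sD mB ->]]] [D' [B' [sD' mB' ->]]].
exists (D `&` D'), (B `&` B'); split; last by rewrite preimage_setI setIACA.
- exact: (@measurableI _ SX).
- exact: measurableI.
Qed.

Lemma genXY_setT : genXY setT.
Proof.
exists setT, setT; split => //; last by rewrite preimage_setT setIT.
exact: (@measurableT _ SX).
Qed.

Lemma genXY_measurable D : genXY D -> measurable D.
Proof.
move=> [D' [B [sD mB ->]]]; apply: measurableI; first exact: sigmaX_sub_measurable.
by rewrite -[X in measurable X]setTI; exact: mY.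
Qed.

Notation SXY := (g_sigma_algebraType genXY).

Lemma measurable_id_SXY : measurable_fun setT (idfun : T -> SXY).
Proof. by apply: measurable_gen => B; exact: genXY_measurable. Qed.

Lemma measurable_SX_SXY (f : T -> R) : measurable_fun setT (f : SX -> R) ->
  measurable_fun setT (f : SXY -> R).
Proof.
move=> mf _ B mB; rewrite setTI; apply: sub_sigma_algebra.
exists (f @^-1` B), setT; split => //; last by rewrite preimage_setT setIT.
by have := mf measurableT B mB; rewrite setTI.
Qed.

Lemma measurable_Y_SXY : measurable_fun setT (Y : SXY -> R).
Proof.
move=> _ B mB; rewrite setTI; apply: sub_sigma_algebra.
by exists setT, B; split => //; [exact: (@measurableT _ SX)|rewrite setTI].
Qed.

Let A : set R := [set 1].
Let Rind w : Rv w = \1_(Rv @^-1` A) w.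
Proof.
rewrite indicE; case: (R01 w) => Rw.
  by rewrite memNset // /A /= Rw => /esym/eqP; rewrite oner_eq0.
by rewrite mem_set // /A /= Rw.
Qed.

(* The propensity score [E(R | X)] may be substituted for [R] in front of any function of [(X, Y)]. *)
Lemma missing_at_random : exists g : T -> R,
  [/\ measurable_fun setT (g : SX -> R), forall w, 0 <= g w &
  forall h : T -> R, measurable_fun setT (h : g_sigma_algebraType genXY -> R) ->
    (forall w, 0 <= h w) ->
    (\int[P]_w (h w * Rv w)%:E = \int[P]_w (h w * g w)%:E)%E].
Proof.
have mA : measurable A by exact: measurable_set1.
have mRA : measurable (Rv @^-1` A) by rewrite -[X in measurable X]setTI; exact: mR.
have mYB B : measurable B -> measurable (Y @^-1` B).
  by move=> mB; rewrite -[X in measurable X]setTI; exact: mY.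
have ind0 (E : set T) w : 0 <= (\1_E w : R) by rewrite indicE.
(* The version of E(R | X) provided by [ci] may change with the set tested against Y. One is fixed
   here, with an arbitrary test set, and uniqueness of versions identifies the later ones with
   it. *)
have [gA0 [_ [_ [cA0 _ _ _]]]] := ci _ _ mA mA.
have cA := cond_exp_version_pos _ _ (ind0 _) cA0.
set g := (fun w => Num.max (gA0 w) 0) in cA.
have [iA sgA igA HA] := cA.
have mg := sigmaX_measurable_SX _ sgA; have mg' := measurable_of_SX _ mg.
have g0 w : 0 <= g w by rewrite /g le_max lexx orbT.
exists g; split => // h mh h0.
have key (D : set T) B : sigmaX X D -> measurable B ->
    (\int[P]_(w in D `&` Y @^-1` B) (Rv w)%:E = \int[P]_(w in D `&` Y @^-1` B) (g w)%:E)%E.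
  move=> sD mB; have mD := sigmaX_sub_measurable _ sD.
  have [gA1 [gB0 [gAB [cA1 cB0 cAB aeAB]]]] := ci _ _ mA mB.
  have cB := cond_exp_version_pos _ _ (ind0 _) cB0.
  set gB := (fun w => Num.max (gB0 w) 0) in cB.
  have [iB sgB igB HB] := cB.
  have mgB := sigmaX_measurable_SX _ sgB; have mgB' := measurable_of_SX _ mgB.
  have gB0' w : 0 <= gB w by rewrite /gB le_max lexx orbT.
  have aeB := cond_exp_version_ge0 _ _ (ind0 _) cB0.
  have aeA1 := cond_exp_version_ge0 _ _ (ind0 _) cA1.
  have aeA : {ae P, forall w, gA1 w = g w}.
    apply: filterS2 (cond_exp_version_unique _ _ _ cA1 cA0) aeA1 => w e1 h1.
    by rewrite /g -e1 max_l.
  have mID : measurable_fun setT (\1_D : SX -> R) by apply: measurable_indic.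
  (* Taking out what is known: the indicator of Y in B and its conditional mean [gB] agree on
     sigma(X), hence against the sigma(X)-measurable g 1_D. *)
  have takeout : (\int[P]_w (g w * \1_D w * \1_(Y @^-1` B) w)%:E
      = \int[P]_w (g w * \1_D w * gB w)%:E)%E.
    apply: (@transfer_integral _ _ _ P _ (cylX X) idfun idfun (\1_(Y @^-1` B)) gB
      measurable_id_SX measurable_id_SX _ mgB' (ind0 _) gB0' _ cylX_setI cylX_setT _
      (fun w => g w * \1_D w) _ _) => //.
    - by apply: measurable_indic; exact: mYB.
    - by have /integrable_lty := iB; apply.
    - by move=> E cE; rewrite !preimage_id; apply: HB; exact: sub_sigma_algebra.
    - exact: measurable_funM.
    - by move=> w; rewrite mulr_ge0.
  have mkR (f : T -> R) : (\int[P]_(w in D `&` Y @^-1` B) (f w)%:E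
      = \int[P]_w (f w * \1_D w * \1_(Y @^-1` B) w)%:E)%E.
    rewrite integral_mkcond; apply: eq_integral => w _; rewrite patchE in_setI !indicE.
    by case: (w \in D); case: (w \in _) => /=; rewrite ?mulr1 ?mulr0 ?mul0r.
  rewrite [RHS]mkR takeout.
  have [_ sAB iAB HAB] := cAB.
  have mgAB := measurable_of_SX _ (sigmaX_measurable_SX _ sAB).
  transitivity (\int[P]_(w in D) (gAB w)%:E)%E.
    rewrite -HAB // integral_mkcondr; apply: eq_integral => w _.
    by rewrite patchE Rind !indicE; case: (w \in Y @^-1` B); rewrite ?mulr1 ?mulr0.
  rewrite integral_mkcond.
  apply: ae_eq_integral => //.
  - apply/(measurable_restrictT _ mD); apply/measurable_EFinP; exact: measurable_funTS.
  - apply/measurable_EFinP; apply: measurable_funM; last exact: mgB'.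
    by apply: measurable_funM; [exact: mg'|exact: measurable_of_SX mID].
  - apply: filterS3 aeA aeAB aeB => w eA eAB gB0w _.
    rewrite patchE indicE; case: (w \in D); rewrite ?mulr1 ?mulr0 ?mul0r //.
    by rewrite eAB eA /gB max_l.
apply: (@transfer_integral _ _ _ P _ genXY idfun idfun Rv g measurable_id_SXY
  measurable_id_SXY mR mg' _ g0 _ genXY_setI genXY_setT _ h mh h0).
- by move=> w; rewrite Rind.
- under eq_integral do rewrite Rind.
  by have /integrable_lty := iA; apply.
- by move=> _ [D [B [sD mB ->]]]; rewrite !preimage_id; exact: key.
Qed.

(** Both exchanges, R for g and one density for another, concern nonnegative functions, so eps is
    split into its parts. E(eps | X) = 0 says that the parts have the same integral against any
    nonnegative sigma(X)-measurable function, in particular g x. Integrability of R x eps makes the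
    final difference meaningful. *)
Lemma missing_at_random_mean0 (x eps : T -> R) :
  measurable_fun setT (x : SX -> R) -> (forall w, 0 <= x w) ->
  measurable_fun setT (eps : SXY -> R) -> cond_exp_version P X eps (fun=> 0) ->
  P.-integrable setT (fun w => (Rv w * x w * eps w)%:E) ->
  (\int[P]_w (Rv w * x w * eps w)%:E = 0)%E.
Proof.
move=> mx x0 me [ie _ _ He] iRxe.
have [g [mg g0 Hg]] := missing_at_random.
have mx' := measurable_of_SX _ mx; have mg' := measurable_of_SX _ mg.
have me' : measurable_fun setT eps by exact: (measurableT_comp me measurable_id_SXY).
pose ep w := Num.max (eps w) 0; pose en w := Num.max (- eps w) 0.
have epn w : eps w = ep w - en w.
  by rewrite /ep /en; case: (leP (eps w) 0) => h; case: (leP (- eps w) 0) => h'; lra.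
have ep0 w : 0 <= ep w by rewrite /ep le_max lexx orbT.
have en0 w : 0 <= en w by rewrite /en le_max lexx orbT.
have ep_le w : ep w <= `|eps w|.
  by rewrite /ep ge_max ler_norm normr_ge0.
have en_le w : en w <= `|eps w|.
  by rewrite /en ge_max normr_ge0 andbT -normrN ler_norm.
have mep : measurable_fun setT (ep : SXY -> R) by exact: measurable_maxr.
have men : measurable_fun setT (en : SXY -> R).
  by apply: measurable_maxr => //; exact: measurableT_comp.
have mep' : measurable_fun setT ep by exact: (measurableT_comp mep measurable_id_SXY).
have men' : measurable_fun setT en by exact: (measurableT_comp men measurable_id_SXY).
have iep : P.-integrable setT (EFin \o ep).
  apply: (le_integrable measurableT _ _ ie); first exact/measurable_EFinP.
  by move=> w _ /=; rewrite lee_fin ger0_norm.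
have ien : P.-integrable setT (EFin \o en).
  apply: (le_integrable measurableT _ _ ie); first exact/measurable_EFinP.
  by move=> w _ /=; rewrite lee_fin ger0_norm.
have balanced : (\int[P]_w (g w * x w * ep w)%:E = \int[P]_w (g w * x w * en w)%:E)%E.
  apply: (@transfer_integral _ _ _ P _ (cylX X) idfun idfun ep en measurable_id_SX
    measurable_id_SX mep' men' ep0 en0 _ cylX_setI cylX_setT _ (fun w => g w * x w)).
  - by have /integrable_lty := iep; apply.
  - move=> D cD; rewrite !preimage_id; have mD := cylX_measurable _ cD.
    have ipD : P.-integrable D (EFin \o ep) by exact: (integrableS measurableT mD _ iep).
    have inD : P.-integrable D (EFin \o en) by exact: (integrableS measurableT mD _ ien).
    have sD : sigmaX X D by exact: sub_sigma_algebra.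
    have := He D sD; rewrite integral0.
    under eq_integral do rewrite epn EFinB.
    rewrite (integralB mD ipD inD) => /eqP; rewrite sube_eq ?add0e; first by move=> /eqP.
    - by rewrite integrable_fin_num.
    - by apply: fin_num_adde_defl; rewrite integrable_fin_num.
  - exact: measurable_funM.
  - by move=> w; rewrite mulr_ge0.
have RE (f : T -> R) : measurable_fun setT (f : SXY -> R) -> (forall w, 0 <= f w) ->
    (\int[P]_w (Rv w * x w * f w)%:E = \int[P]_w (g w * x w * f w)%:E)%E.
  move=> mf f0; have := Hg (fun w => x w * f w) _ (fun w => mulr_ge0 (x0 w) (f0 w)).
  move=> /(_ (measurable_funM (measurable_SX_SXY _ mx) mf)) h.
  rewrite (_ : (fun w => _) = fun w => (x w * f w * Rv w)%:E); last first.
    by apply/funext => w; congr EFin; ring.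
  by rewrite h; apply: eq_integral => w _; congr EFin; ring.
have R0 w : 0 <= Rv w by case: (R01 w) => ->.
have dom (f : T -> R) : measurable_fun setT f -> (forall w, 0 <= f w) ->
    (forall w, f w <= `|eps w|) -> P.-integrable setT (fun w => (Rv w * x w * f w)%:E).
  move=> mf f0 fe; apply: (le_integrable measurableT _ _ iRxe).
    by apply/measurable_EFinP; apply: measurable_funM => //; exact: measurable_funM.
  move=> w _ /=; rewrite lee_fin !normrM ler_wpM2l ?mulr_ge0 //.
  by rewrite ger0_norm.
under eq_integral do rewrite epn mulrBr EFinB.
rewrite (integralB measurableT (dom ep mep' ep0 ep_le) (dom en men' en0 en_le)).
rewrite (RE _ mep ep0) balanced -(RE _ men en0) subee //.
exact: (integrable_fin_num measurableT (dom en men' en0 en_le)).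
Qed.

End missingness.
End conditional_mean.

(** * The probabilistic model *)

Section observation_space.
Context {R : realType} {d : nat}.

Definition obs : pointedType := (R * R * ('I_d -> R))%type.

Definition box (A B : set R) (C : 'I_d -> set R) : set obs :=
  [set x | A x.1.1 /\ B x.1.2 /\ forall j, C j (x.2 j)].

(** Their preimages under [obs_of] are the sets [cyl3], so both clauses of [iid_copies] become the
    hypotheses on a generating pi-system in [chernoff_iid]. *)
Definition boxes : set (set obs) :=
  [set D | exists A B C, [/\ measurable A, measurable B, forall j, measurable (C j) & D = box A B C]].

Notation OT := (g_sigma_algebraType boxes).

Lemma boxes_setI : setI_closed boxes.
Proof.
move=> _ _ [A [B [C [mA mB mC ->]]]] [A' [B' [C' [mA' mB' mC' ->]]]].
exists (A `&` A'), (B `&` B'), (fun j => C j `&` C' j); split.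
- exact: measurableI.
- exact: measurableI.
- by move=> j; exact: measurableI.
- apply/seteqP; split=> x /=.
    by move=> [[a [b c]] [a' [b' c']]]; repeat split.
  move=> [[a a'] [[b b'] c]]; split; (split; [done|split; [done|]]) => j; by case: (c j).
Qed.

Lemma boxes_setT : boxes setT.
Proof. by exists setT, setT, (fun=> setT); split => //; apply/seteqP; split. Qed.

Lemma measurable_obs1 : measurable_fun setT ((fun x => x.1.1) : OT -> R).
Proof.
move=> _ B mB; rewrite setTI; apply: sub_sigma_algebra.
exists B, setT, (fun=> setT); split => //.
by apply/seteqP; split=> x /=; [split|case].
Qed.

Lemma measurable_obs2 : measurable_fun setT ((fun x => x.1.2) : OT -> R).
Proof.
move=> _ B mB; rewrite setTI; apply: sub_sigma_algebra.
exists setT, B, (fun=> setT); split => //.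
by apply/seteqP; split=> x /=; [split|case=> _ []].
Qed.

Lemma measurable_obs3 j : measurable_fun setT ((fun x => x.2 j) : OT -> R).
Proof.
move=> _ B mB; rewrite setTI; apply: sub_sigma_algebra.
exists setT, setT, (fun k => if k == j then B else setT); split => //.
  by move=> k; case: ifP.
apply/seteqP; split=> x /=.
  by move=> h; split=> //; split=> // k; case: eqP => [->|].
by move=> [_ [_ /(_ j)]]; rewrite eqxx.
Qed.

Lemma measurable_obs_dotv (u : 'I_d -> R) : measurable_fun setT ((fun x => dotv x.2 u) : OT -> R).
Proof.
by apply: measurable_sum => j; apply: measurable_funM => //; exact: measurable_obs3.
Qed.

Context {dsp : measure_display} {T : measurableType dsp}.

Definition obs_of (Y Rv : T -> R) (X : 'I_d -> T -> R) (w : T) : OT := ((Y w, Rv w), at_ X w).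

Lemma measurable_obs_of (Y Rv : T -> R) (X : 'I_d -> T -> R) :
  measurable_fun setT Y -> measurable_fun setT Rv -> (forall j, measurable_fun setT (X j)) ->
  measurable_fun setT (obs_of Y Rv X).
Proof.
move=> mY mR mX; apply: measurable_gen => _ [A [B [C [mA mB mC ->]]]].
have mp (f : T -> R) (D : set R) : measurable_fun setT f -> measurable D -> measurable (f @^-1` D).
  by move=> mf mD; rewrite -[X in measurable X]setTI; exact: mf.
rewrite (_ : _ @^-1` _ = (Y @^-1` A `&` Rv @^-1` B) `&` \bigcap_j (X j @^-1` C j)); last first.
  apply/seteqP; split=> w /=.
    by move=> [a [b c]]; split => // j _; exact: c.
  by move=> [[a b] c]; split => //; split => // j; exact: c.
apply: measurableI; first by apply: measurableI; exact: mp.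
by apply: fin_bigcap_measurable => [|j _]; [exact: finite_finset|exact: mp].
Qed.

End observation_space.

Section good_events.
Context {dsp : measure_display} {T : measurableType dsp} {R : realType}.
Variable P : probability T R.

Lemma good_event {I : eqType} (l : seq I) (S : I -> set T) (p : R) :
  (forall i, measurable (S i)) -> (forall i, (P (S i) <= p%:E)%E) ->
  exists E, [/\ measurable E, (P (~` E) <= ((size l)%:R * p)%:E)%E &
    forall w, E w -> forall i, i \in l -> ~ S i w].
Proof.
move=> mS pS; elim: l => [|i l [E [mE pE HE]]].
  by exists setT; split => //; rewrite setCT measure0 mul0r.
exists (E `&` ~` S i); split.
- by apply: measurableI => //; exact: measurableC.
- rewrite setCI setCK /=; apply: le_trans (measureU2 _ _ _) _ => //; first exact: measurableC.
  by rewrite -natr1 mulrDl mul1r EFinD; apply: leeD; [exact: pE|exact: pS].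
- move=> w [Ew Sw] k; rewrite inE => /orP[/eqP ->//|]; exact: HE.
Qed.

Lemma good_eventI (E1 E2 : set T) (p1 p2 : R) : measurable E1 -> measurable E2 ->
  (P (~` E1) <= p1%:E)%E -> (P (~` E2) <= p2%:E)%E -> (P (~` (E1 `&` E2)) <= (p1 + p2)%:E)%E.
Proof.
move=> m1 m2 h1 h2; rewrite setCI; apply: le_trans (measureU2 _ _ _) _; try exact: measurableC.
by rewrite EFinD; apply: leeD; [exact: h1|exact: h2].
Qed.

Lemma good_event_ge (E : set T) (p : R) : measurable E -> (P (~` E) <= p%:E)%E ->
  ((1 - p)%:E <= P E)%E.
Proof.
move=> mE h; rewrite -[E]setCK probability_setC; last exact: measurableC.
by rewrite EFinB; apply: leeB; [|exact: h].
Qed.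

(** The slack r < c avoids asking whether the infimum is attained: some admissible t lies below c.
    It is the source of the doubled Orlicz norms below. *)
Lemma psi2_expectation_le2 (Z : T -> R) (r c : R) : measurable_fun setT Z ->
  (psi2 P Z <= r%:E)%E -> r < c -> (\int[P]_w (expR (Z w ^+ 2 / c ^+ 2))%:E <= 2%:E)%E.
Proof.
move=> mZ h rc.
have : (psi2 P Z < c%:E)%E by apply: le_lt_trans h _; rewrite lte_fin.
move=> /ereal_inf_lt[_ [t [t0 ht] <-]]; rewrite lte_fin => tc.
move: ht; rewrite unlock; apply: le_trans.
have mexp a : measurable_fun setT (fun w => (expR (Z w ^+ 2 / a))%:E).
  apply/measurable_EFinP; apply: measurableT_comp => //; apply: measurable_funM => //.
  exact: measurable_funX.
apply: ge0_le_integral => //.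
move=> w _; rewrite lee_fin ler_expR ler_wpM2l ?sqr_ge0 //.
have c0 : 0 < c := lt_trans t0 tc.
by rewrite lef_pV2 ?posrE ?exprn_gt0 // lerXn2r ?nnegrE ?ltW.
Qed.

End good_events.

Section second_moments.
Context {dsp : measure_display} {T : measurableType dsp} {R : realType}.
Variable P : probability T R.
Context {d : nat} (X : 'I_d -> T -> R) (r : T -> R).
Hypotheses (mX : forall j, measurable_fun setT (X j)) (mr : measurable_fun setT r).
Hypothesis r01 : forall w, 0 <= r w <= 1.
Hypothesis iX : forall j, P.-integrable setT (EFin \o (fun w => X j w ^+ 2)).

(** The weight serves both matrices: r = 1 gives Sigma and r = R gives Sigma_R. *)
Definition moment2 (j k : 'I_d) : R := fine (\int[P]_w (r w * (X j w * X k w))%:E).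

Lemma moment2_sym j k : moment2 j k = moment2 k j.
Proof. by congr fine; apply: eq_integral => w _; congr EFin; ring. Qed.

Lemma integrable_moment2 j k : P.-integrable setT (fun w => (r w * (X j w * X k w))%:E).
Proof.
have iS : P.-integrable setT (fun w => (X j w ^+ 2)%:E + (X k w ^+ 2)%:E)%E by exact: (integrableD measurableT (iX j) (iX k)).
apply: (le_integrable measurableT _ _ iS).
  by apply/measurable_EFinP; apply: measurable_funM => //; exact: measurable_funM.
move=> w _; rewrite -EFinD /= lee_fin [leRHS]ger0_norm ?addr_ge0 ?sqr_ge0 //.
have /andP[r0 r1] := r01 w; rewrite !normrM (ger0_norm r0).
have h : `|X j w| * `|X k w| <= X j w ^+ 2 + X k w ^+ 2.
  have := sqr_ge0 (`|X j w| - `|X k w|); rewrite sqrrB !real_normK ?num_real //.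
  have := sqr_ge0 (X j w); have := sqr_ge0 (X k w); rewrite -mulr_natl; lra.
apply: le_trans h; rewrite -[leRHS]mul1r ler_wpM2r // mulr_ge0.
Qed.

Lemma integral_qform (u : 'I_d -> R) :
  (\int[P]_w (r w * dotv (at_ X w) u ^+ 2)%:E = (qform moment2 u)%:E)%E.
Proof.
transitivity (\int[P]_w \sum_(j < d) \sum_(k < d) ((u j * u k)%:E * (r w * (X j w * X k w))%:E))%E.
  apply: eq_integral => w _; rewrite -qform_rank1 /qform /bform mulr_sumr -sumEFin.
  apply: eq_bigr => j _; rewrite mulr_sumr -sumEFin; apply: eq_bigr => k _.
  by rewrite -EFinM; congr EFin; rewrite /at_; ring.
have i2 j k : P.-integrable setT (fun w => (u j * u k)%:E * (r w * (X j w * X k w))%:E)%E.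
  by apply: integrableZl => //; exact: integrable_moment2.
rewrite integral_sum //; last by move=> j; apply: integrable_sum.
rewrite /qform /bform -sumEFin; apply: eq_bigr => j _.
rewrite integral_sum // -sumEFin; apply: eq_bigr => k _.
rewrite integralZl //; last exact: integrable_moment2.
by rewrite [RHS]EFinM /moment2 fineK // integrable_fin_num //; exact: integrable_moment2.
Qed.

Lemma qform_moment2_ge0 u : 0 <= qform moment2 u.
Proof.
rewrite -lee_fin -integral_qform; apply: integral_ge0 => w _.
by have /andP[r0 _] := r01 w; rewrite lee_fin mulr_ge0 ?sqr_ge0.
Qed.

End second_moments.

(* [lattice_pt] depends only on the multiset of its letters, and counting multisets rather than words is
   what yields [s log (ed / s)] instead of [s log d]. *)
Lemma sorted_representatives (d m : nat) : (0 < d)%N ->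
  exists2 l : seq (seq 'I_(d + d)), size l = 'C(m + d + d, m.+1) &
    forall t, size t = m.+1 -> exists2 u, u \in l & perm_eq t u.
Proof.
case: d => // d _; pose n := (d + d.+1)%N.
pose A := [set t : m.+1.-tuple 'I_n.+1 | sorted leq (map val t)]%SET.
exists (map val (enum A)).
  have -> : (m + d.+1 + d.+1 = m.+1 + n)%N by rewrite /n; lia.
  by rewrite size_map -cardE; exact: card_sorted_tuples.
move=> t tm; pose u : seq 'I_n.+1 := sort (relpre val leq) t.
have su : size u == m.+1 by rewrite size_sort tm.
exists u; last by rewrite perm_sym perm_sort.
apply/mapP; exists (Tuple su) => //; rewrite mem_enum inE /= sorted_map.
by apply: sort_sorted => a b; exact: leq_total.
Qed.

Section model.
Context {dsp : measure_display} {T : measurableType dsp} {R : realType}.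
Variable P : probability T R.
Context {d n : nat} (Ys Rs : 'I_n -> T -> R) (Xs : 'I_n -> 'I_d -> T -> R).
Variables (Y Rv : T -> R) (X : 'I_d -> T -> R) (K : R).
Hypotheses (mY : measurable_fun setT Y) (mR : measurable_fun setT Rv)
  (mX : forall j, measurable_fun setT (X j)) (mYs : forall i, measurable_fun setT (Ys i))
  (mRs : forall i, measurable_fun setT (Rs i)) (mXs : forall i j, measurable_fun setT (Xs i j)).
Hypotheses (R01 : forall w, Rv w = 0 \/ Rv w = 1) (Rs01 : forall i w, Rs i w = 0 \/ Rs i w = 1).
Hypothesis iid : iid_copies P Ys Rs Xs Y Rv X.
Hypothesis n0 : (0 < n)%N.

Notation OT := (g_sigma_algebraType (@boxes R d)).
Let Phi i : T -> OT := obs_of (Ys i) (Rs i) (Xs i).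
Let Phi0 : T -> OT := obs_of Y Rv X.
Let mPhi i : measurable_fun setT (Phi i).
Proof. exact: measurable_obs_of. Qed.
Let mPhi0 : measurable_fun setT Phi0.
Proof. exact: measurable_obs_of. Qed.

Let indep (B : 'I_n -> set OT) : (forall i, boxes (B i)) ->
  P (\bigcap_i (Phi i @^-1` B i)) = (\prod_(i < n) fine (P (Phi i @^-1` B i)))%:E.
Proof.
move=> HB.
have /choice[f Hf] : forall i, exists q : set R * set R * ('I_d -> set R),
    [/\ measurable q.1.1, measurable q.1.2, forall j, measurable (q.2 j) & B i = box q.1.1 q.1.2 q.2].
  by move=> i; have [A [B' [C [mA mB mC ->]]]] := HB i; exists (A, B', C).
have := iid.2 (fun i => (f i).1.1) (fun i => (f i).1.2) (fun i => (f i).2).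
have -> : (fun i => Phi i @^-1` B i) =
    fun i => cyl3 (Ys i) (Rs i) (Xs i) (f i).1.1 (f i).1.2 (f i).2.
  by apply/funext => i; have [_ _ _ ->] := Hf i.
have e i : Phi i @^-1` B i = cyl3 (Ys i) (Rs i) (Xs i) (f i).1.1 (f i).1.2 (f i).2.
  by have [_ _ _ ->] := Hf i.
move=> h; rewrite h => [|i|i|i j].
- by congr EFin; apply: eq_bigr => i _; rewrite e.
- by have [] := Hf i.
- by have [] := Hf i.
- by have [_ _ + _] := Hf i; apply.
Qed.

Let law i (B : set OT) : boxes B -> P (Phi i @^-1` B) = P (Phi0 @^-1` B).
Proof. by move=> [A [B' [C [mA mB mC ->]]]]; exact: iid.1. Qed.

(* [28 = 4 * (6 + 1)] is the deviation for which [chernoff_iid] gives the exponent [6 n tau ^ 2]. *)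
Definition upper_tail (W : OT -> R) (tau : R) : set T :=
  [set w | n%:R * (fine (\int[P]_w (W (Phi0 w))%:E)%E + 28 * tau) <= \sum_(i < n) W (Phi i w)].

Lemma measurable_upper_tail (W : OT -> R) tau : measurable_fun setT W -> measurable (upper_tail W tau).
Proof.
move=> mW; rewrite /upper_tail -[X in measurable X]setTI.
apply: (@measurable_fun_le _ _ _ setT (fun=> n%:R * _) (fun w => \sum_(i < n) W (Phi i w))) => //.
by apply: measurable_sum => i; exact: measurableT_comp.
Qed.

Lemma prob_upper_tail (W : OT -> R) tau : measurable_fun setT W ->
  (\int[P]_w (expR `|W (Phi0 w)|)%:E <= 2%:E)%E -> 0 <= tau <= 1 ->
  (P (upper_tail W tau) <= (expR (- (6 * (n%:R * tau ^+ 2))))%:E)%E.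
Proof.
move=> mW W2 tau01.
have := @chernoff_iid _ _ _ P _ _ (@boxes_setI R d) (@boxes_setT R d) n Phi Phi0 mPhi mPhi0 indep law
  W 28 tau mW W2 tau01.
move=> h; apply: le_trans h _; rewrite lee_fin ler_expR lerN2.
by rewrite le_eqVlt; apply/orP; left; apply/eqP; field.
Qed.

Hypothesis K0 : 0 < K.
Hypothesis iX : forall j, P.-integrable setT (EFin \o (fun w => X j w ^+ 2)).
Hypothesis subG : forall u : 'I_d -> R, (psi2 P (fun w => dotv (at_ X w) u)
  <= (K * Num.sqrt (fine ('E_P[fun w => (dotv (at_ X w) u ^+ 2)%R])%E))%:E)%E.

Let Sig := moment2 P X (fun=> 1).
Let SigR := moment2 P X Rv.

Let one01 (w : T) : 0 <= (1 : R) <= 1. Proof. by rewrite ler01 lexx. Qed.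
Let Rv01 w : 0 <= Rv w <= 1. Proof. by case: (R01 w) => ->; rewrite ?lexx ?ler01. Qed.

Let expectation_dotv2 u : ('E_P[fun w => (dotv (at_ X w) u ^+ 2)%R] = (qform Sig u)%:E)%E.
Proof.
rewrite unlock -(integral_qform P X (fun=> 1) mX (measurable_cst _) one01 iX).
by apply: eq_integral => w _; rewrite mul1r.
Qed.

Let expectation_R_dotv2 u : ('E_P[fun w => (Rv w * dotv (at_ X w) u ^+ 2)%R] = (qform SigR u)%:E)%E.
Proof. by rewrite unlock -(integral_qform P X Rv mX mR Rv01 iX). Qed.

Let psd u : 0 <= qform Sig u.
Proof. exact: qform_moment2_ge0. Qed.
Let psdR u : 0 <= qform SigR u.
Proof. exact: qform_moment2_ge0. Qed.

Let mdotv u : measurable_fun setT (fun w => dotv (at_ X w) u).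
Proof. by apply: measurable_sum => j; apply: measurable_funM => //; exact: mX. Qed.

Let qformR_le u : qform SigR u <= qform Sig u.
Proof.
rewrite -lee_fin -expectation_dotv2 -expectation_R_dotv2 unlock.
apply: ge0_le_integral => //.
- by move=> w _; have /andP[r0 _] := Rv01 w; rewrite lee_fin mulr_ge0 ?sqr_ge0.
- by apply/measurable_EFinP; apply: measurable_funM; [exact: mR|apply: measurable_funX; exact: mdotv].
- by apply/measurable_EFinP; apply: measurable_funX; exact: mdotv.
- move=> w _; have /andP[_ r1] := Rv01 w.
  by rewrite lee_fin -[leRHS]mul1r ler_wpM2r ?sqr_ge0.
Qed.

Lemma exp_moment_dotv u v : qform Sig u <= v -> 0 < v ->
  (\int[P]_w (expR (dotv (at_ X w) u ^+ 2 / (4 * K ^+ 2 * v)))%:E <= 2%:E)%E.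
Proof.
move=> uv v0; have := subG u; rewrite expectation_dotv2 /= => h.
have sv : 0 < Num.sqrt v by rewrite sqrtr_gt0.
have lt : K * Num.sqrt (qform Sig u) < 2 * K * Num.sqrt v.
  have le : Num.sqrt (qform Sig u) <= Num.sqrt v by rewrite ler_wsqrtr.
  by have := ler_wpM2l (ltW K0) le; have := mulr_gt0 K0 sv; lra.
have := psi2_expectation_le2 P _ _ _ (mdotv u) h lt.
have -> : (2 * K * Num.sqrt v) ^+ 2 = 4 * K ^+ 2 * v.
  by rewrite exprMn sqr_sqrtr ?(ltW v0) //; ring.
by [].
Qed.

(* For [v = 0], division by zero makes this variable vanish, so the tail bound remains true. *)
Definition Wquad (sg : R) (u : 'I_d -> R) (v : R) (x : OT) : R :=
  sg * (x.1.2 * dotv x.2 u ^+ 2 / (4 * K ^+ 2 * v)).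

Lemma measurable_Wquad sg u v : measurable_fun setT (Wquad sg u v).
Proof.
apply: measurable_funM => //; apply: measurable_funM => //; apply: measurable_funM.
  exact: measurable_obs2.
by apply: measurable_funX; exact: measurable_obs_dotv.
Qed.

Lemma exp_moment_Wquad sg u v : `|sg| = 1 -> qform Sig u <= v ->
  (\int[P]_w (expR `|Wquad sg u v (Phi0 w)|)%:E <= 2%:E)%E.
Proof.
move=> sg1 uv; have [v0|v0] := leP v 0.
  have -> : v = 0 by apply/eqP; rewrite eq_le v0 (le_trans (psd u) uv).
  under eq_integral do rewrite /Wquad mulr0 invr0 !mulr0 normr0 expR0.
  by rewrite integral_cst // [X in (_ * X)%E](probability_setT P) mule1 lee_fin ler1n.
apply: le_trans (exp_moment_dotv u v uv v0).
have mdot2 : measurable_fun setT (fun w => dotv (at_ X w) u ^+ 2) by exact: measurable_funX.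
apply: ge0_le_integral => //.
- apply/measurable_EFinP; apply: measurableT_comp => //; apply: measurableT_comp => //.
  exact: (measurableT_comp (measurable_Wquad sg u v) mPhi0).
- apply/measurable_EFinP; apply: measurableT_comp => //; exact: measurable_funM.
- move=> w _; rewrite lee_fin ler_expR /Wquad normrM sg1 mul1r /=.
  have c0 : 0 < 4 * K ^+ 2 * v by rewrite !mulr_gt0 ?exprn_gt0.
  have /andP[r0 r1] := Rv01 w.
  have q0 := sqr_ge0 (dotv (at_ X w) u).
  rewrite ger0_norm; last by apply: divr_ge0; [exact: mulr_ge0|exact: ltW].
  by rewrite ler_wpM2r ?invr_ge0 ?(ltW c0) // -[leRHS]mul1r ler_wpM2r ?sqr_ge0.
Qed.

Lemma mean_Wquad sg u v :
  fine (\int[P]_w (Wquad sg u v (Phi0 w))%:E)%E = sg * (qform SigR u / (4 * K ^+ 2 * v)).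
Proof.
have iRd : P.-integrable setT (fun w => (Rv w * dotv (at_ X w) u ^+ 2)%:E).
  apply/integrableP; split.
    by apply/measurable_EFinP; apply: measurable_funM => //; exact: measurable_funX.
  rewrite (_ : \int[P]_w _ = (qform SigR u)%:E)%E ?ltry //.
  rewrite -(integral_qform P X Rv mX mR Rv01 iX); apply: eq_integral => w _.
  by have /andP[r0 _] := Rv01 w; rewrite gee0_abs // lee_fin mulr_ge0 ?sqr_ge0.
set c := 4 * K ^+ 2 * v.
transitivity (fine (\int[P]_w ((sg / c)%:E * (Rv w * dotv (at_ X w) u ^+ 2)%:E))%E).
  by congr fine; apply: eq_integral => w _; rewrite -EFinM /Wquad -/c /=; congr EFin; ring.
by rewrite integralZl // (integral_qform P X Rv mX mR Rv01 iX) /= /SigR; ring.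
Qed.

(** Here 112 = 28 * 4, the Chernoff deviation times the normalisation of [Wquad]. Since only upper
    tails are bounded, sg = -1 is what gives lower bounds. *)
Lemma not_upper_tail_Wquad sg u v tau w : 0 < v -> ~ upper_tail (Wquad sg u v) tau w ->
  sg * qform (empirical_gram Rs Xs w) u < sg * qform SigR u + 112 * K ^+ 2 * tau * v.
Proof.
move=> v0 /negP; rewrite /upper_tail /= mean_Wquad -ltNge.
have c0 : 0 < 4 * K ^+ 2 * v by rewrite !mulr_gt0 ?exprn_gt0.
have -> : \sum_(i < n) Wquad sg u v (Phi i w)
    = n%:R * (sg * qform (empirical_gram Rs Xs w) u / (4 * K ^+ 2 * v)).
  rewrite qform_empirical_gram.
  rewrite [RHS](_ : _ = sg / (4 * K ^+ 2 * v) * \sum_(i < n) Rs i w * dotv (at_ (Xs i) w) u ^+ 2).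
    by rewrite mulr_sumr; apply: eq_bigr => i _; rewrite /Wquad /=; ring.
  by field; rewrite !gt_eqF ?ltr0n.
have np : 0 < n%:R :> R by rewrite ltr0n.
rewrite (ltr_pM2l np) ltr_pdivrMr // mulrDl.
have -> : sg * (qform SigR u / (4 * K ^+ 2 * v)) * (4 * K ^+ 2 * v) = sg * qform SigR u.
  by field; rewrite !gt_eqF.
lra.
Qed.

Section sparse_eigenvalue.
Variable s : nat.
Hypothesis s1 : (1 <= s)%N.
Let phi := phi_sparse P X s.

(** [phi_sparse] goes through [fine], which would send an infinite supremum to 0; the entrywise
    bound [ub] on the unit sphere excludes this. *)
Lemma qform_le_phi_sparse z : (norm0 z <= s)%N -> qform Sig z <= phi * norm2 z ^+ 2.
Proof.
move=> zs.
set A := [set ('E_P[fun w => (dotv (at_ X w) u ^+ 2)%R])%E | u in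
          [set u : 'I_d -> R | norm2 u = 1 /\ (norm0 u <= s)%N]].
have phiE : phi = fine (ereal_sup A) by [].
have sumsq (u : 'I_d -> R) : 0 <= \sum_j u j ^+ 2 by apply: sumr_ge0 => j _; exact: sqr_ge0.
have ub u : norm2 u = 1 -> qform Sig u <= \sum_(j < d) \sum_(k < d) `|Sig j k|.
  move=> u1; have uj j : `|u j| <= 1.
    rewrite -[leRHS]u1 /norm2 -sqrtr_sqr; apply: ler_wsqrtr.
    rewrite (bigD1 j) //= lerDl; apply: sumr_ge0 => k _; exact: sqr_ge0.
  apply: ler_sum => j _; apply: ler_sum => k _; apply: le_trans (ler_norm _) _.
  rewrite !normrM -[leRHS]mul1r ler_wpM2r // -[leRHS]mulr1.
  by apply: ler_pM.
have key u : norm2 u = 1 -> (norm0 u <= s)%N -> qform Sig u <= phi.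
  move=> u1 us; rewrite -lee_fin phiE fineK.
    by rewrite -expectation_dotv2; apply: ereal_sup_ubound; exists u.
  rewrite fin_numElt; apply/andP; split.
    apply: (@lt_le_trans _ _ (qform Sig u)%:E); first exact: ltNyr.
    by rewrite -expectation_dotv2; apply: ereal_sup_ubound; exists u.
  apply: (@le_lt_trans _ _ (\sum_(j < d) \sum_(k < d) `|Sig j k|)%:E); last exact: ltry.
  apply: ge_ereal_sup => _ [u' [u'1 _] <-]; rewrite expectation_dotv2 lee_fin; exact: ub.
have [z0|z0] := eqVneq (norm2 z) 0.
  have zj j : z j = 0.
    apply/eqP; rewrite -sqrf_eq0 eq_le sqr_ge0 andbT.
    have : \sum_j z j ^+ 2 <= 0 by rewrite -sqrtr_eq0; apply/eqP.
    apply: le_trans; rewrite (bigD1 j) //= lerDl; apply: sumr_ge0 => k _; exact: sqr_ge0.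
  rewrite z0 expr0n mulr0 /qform /bform big1 // => j _; rewrite big1 // => k _.
  by rewrite zj !mul0r.
have zp : 0 < norm2 z by rewrite lt0r z0 sqrtr_ge0.
pose u j := (norm2 z)^-1 * z j.
have u1 : norm2 u = 1.
  rewrite /norm2 /u; under eq_bigr do rewrite exprMn.
  by rewrite -mulr_sumr sqrtrM ?sqr_ge0 // sqrtr_sqr ger0_norm ?invr_ge0 ?sqrtr_ge0 // mulVf.
have us : (norm0 u <= s)%N.
  apply: leq_trans zs; apply: subset_leq_card; apply/fintype.subsetP => j.
  by rewrite !inE /u mulf_eq0 negb_or => /andP[].
have := key u u1 us; rewrite /u qformZ exprVn mulrC ler_pdivrMr // exprn_gt0 //.
Qed.

End sparse_eigenvalue.

(** * The restricted eigenvalue of the empirical Gram matrix *)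

Variables (beta0 : 'I_d -> R) (kappa delta : R).
Let s := norm0 beta0.
Let phi := phi_sparse P X s.
Let L : R := s%:R * ln (expR 1 * d%:R / s%:R).
Let tau : R := Num.sqrt (L / n%:R) + Num.sqrt (ln (delta^-1) / n%:R).
Hypotheses (s1 : (1 <= s)%N) (delta01 : 0 < delta < 1) (kappa0 : 0 < kappa).
Hypothesis tau_lt : tau < Num.min (kappa ^+ 2 / (98 * 112 * K ^+ 2 * phi)) 1.
Hypothesis REpop : forall v : 'I_d -> R, cone1 (supp beta0) 3 v -> norm2 v = 1%R ->
  ((kappa ^+ 2)%:E <= 'E_P[fun w => (Rv w * dotv (at_ X w) v ^+ 2)%R])%E.

Let sd : (1 <= s <= d)%N.
Proof. by rewrite s1 /= -[X in (_ <= X)%N](card_ord d) max_card. Qed.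

Let L1 : 1 <= L. Proof. exact: sparse_entropy_ge1. Qed.

Let ld0 : 0 <= ln (delta^-1).
Proof. by case/andP: delta01 => d0 d1; rewrite ln_ge0 // invf_ge1 // ltW. Qed.

Let np : 0 < n%:R :> R. Proof. by rewrite ltr0n. Qed.

Let entropy_le_tau : L + ln (delta^-1) <= n%:R * tau ^+ 2.
Proof.
have a0 : 0 <= L / n%:R by rewrite divr_ge0 ?(ltW np) // (le_trans ler01).
have b0 : 0 <= ln (delta^-1) / n%:R by rewrite divr_ge0 ?(ltW np).
rewrite /tau sqrrD !sqr_sqrtr // !mulrDr.
have e (x : R) : n%:R * (x / n%:R) = x by rewrite mulrC divfK // gt_eqF.
rewrite !e; have := mulr_ge0 (sqrtr_ge0 (L / n%:R)) (sqrtr_ge0 (ln delta^-1 / n%:R)).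
by move=> h; have := mulr_ge0 (ltW np) h; rewrite -mulr_natl; lra.
Qed.

Let tau01 : 0 <= tau <= 1.
Proof.
apply/andP; split; first by apply: addr_ge0; exact: sqrtr_ge0.
by apply: ltW; apply: lt_le_trans tau_lt _; rewrite ge_min lexx orbT.
Qed.

(** Forced by the sample-size condition: with phi <= 0 the quotient in [tau_lt] would be at most 0
    (division by zero included), whereas tau >= 0. *)
Let phi0 : 0 < phi.
Proof.
have t0 := (andP tau01).1.
have : 0 < kappa ^+ 2 / (98 * 112 * K ^+ 2 * phi).
  by apply: le_lt_trans t0 (lt_le_trans tau_lt _); rewrite ge_min lexx.
rewrite pmulr_rgt0 ?exprn_gt0 // invr_gt0 pmulr_rgt0 //.
by apply: mulr_gt0; [exact: mulr_gt0|exact: exprn_gt0].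
Qed.

Let tau_phi : 98 * 112 * K ^+ 2 * tau * phi <= kappa ^+ 2.
Proof.
have : tau <= kappa ^+ 2 / (98 * 112 * K ^+ 2 * phi).
  by apply: ltW; apply: lt_le_trans tau_lt _; rewrite ge_min lexx.
rewrite ler_pdivlMr; last by apply: mulr_gt0 => //; apply: mulr_gt0; [exact: mulr_gt0|exact: exprn_gt0].
by apply: le_trans; rewrite le_eqVlt; apply/orP; left; apply/eqP; ring.
Qed.

Let delta_exp : expR (- ln (delta^-1)) = delta.
Proof.
by case/andP: delta01 => d0 d1; rewrite expRN lnK ?invrK // posrE invr_gt0.
Qed.

Let REpop_scaled v : cone1 (supp beta0) 3 v -> kappa ^+ 2 * norm2 v ^+ 2 <= qform SigR v.
Proof.
move=> cv; have [z0|z0] := eqVneq (norm2 v) 0.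
  by rewrite z0 expr0n mulr0; exact: psdR.
have zp : 0 < norm2 v by rewrite lt0r z0 sqrtr_ge0.
pose u j := (norm2 v)^-1 * v j.
have u1 : norm2 u = 1.
  rewrite /norm2 /u; under eq_bigr do rewrite exprMn.
  by rewrite -mulr_sumr sqrtrM ?sqr_ge0 // sqrtr_sqr ger0_norm ?invr_ge0 ?sqrtr_ge0 // mulVf.
have cu : cone1 (supp beta0) 3 u.
  have sc (Q : pred 'I_d) : \sum_(j < d | Q j) `|u j| = (norm2 v)^-1 * \sum_(j < d | Q j) `|v j|.
    rewrite mulr_sumr; apply: eq_bigr => j _; rewrite /u normrM ger0_norm // invr_ge0 ltW //.
  by rewrite /cone1 !sc mulrCA ler_pM2l // invr_gt0.
have := REpop u cu u1; rewrite expectation_R_dotv2 lee_fin /u qformZ exprVn mulrC.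
by rewrite ler_pdivlMr // exprn_gt0.
Qed.

Let delta_vec (j : 'I_d) : 'I_d -> R := sgn_unit (lshift d j).

Let qform_delta_vec S j : qform S (delta_vec j) = S j j.
Proof. by rewrite qform_sgn_unit (unsplitK (inl j)). Qed.

Let dotv_delta_vec u j : dotv u (delta_vec j) = u j.
Proof.
rewrite /dotv /delta_vec /sgn_unit (unsplitK (inl j)) (bigD1 j) //= eqxx mulr1.
by rewrite big1 ?addr0 // => k /negbTE ->; rewrite mulr0.
Qed.

Let diag_le (t : nat) j : (1 <= t)%N -> Sig j j <= phi_sparse P X t.
Proof.
move=> t1; have := qform_le_phi_sparse t (delta_vec j).
rewrite qform_delta_vec -qform_id qform_delta_vec eqxx mulr1; apply.
rewrite (leq_trans _ t1) //; have := @norm0_lattice_pt R d [:: lshift d j].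
by rewrite (_ : lattice_pt _ = delta_vec j) //; apply/funext => k; rewrite /lattice_pt big_seq1.
Qed.

Let emp_sym w j k : empirical_gram Rs Xs w j k = empirical_gram Rs Xs w k j.
Proof. by congr (_ * _); apply: eq_bigr => i _; congr (_ * _); rewrite mulrC. Qed.

Let Rs_pos i w : 0 <= Rs i w. Proof. by case: (Rs01 i w) => ->. Qed.

Lemma restricted_eigenvalue_event : exists E, [/\ measurable E, (P (~` E) <= (delta / 2)%:E)%E &
  forall w, E w -> forall v, cone1 (supp beta0) 3 v ->
    kappa ^+ 2 / 2 * norm2 v ^+ 2 <= qform (empirical_gram Rs Xs w) v].
Proof.
pose p := expR (- (6 * (n%:R * tau ^+ 2))).
have pr (sg : R) u v : `|sg| = 1 -> qform Sig u <= v -> (P (upper_tail (Wquad sg u v) tau) <= p%:E)%E.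
  by move=> sg1 uv; apply: prob_upper_tail => //; [exact: measurable_Wquad|exact: exp_moment_Wquad].
have mb sg u v : measurable (upper_tail (Wquad sg u v) tau).
  by apply: measurable_upper_tail; exact: measurable_Wquad.
have d0 : (0 < d)%N by case/andP: sd => h1 h2; exact: leq_trans h1 h2.
have [l lsz lrep] := sorted_representatives d s d0.
(* Words are tested from below, each relative to its own variance; coordinates are tested next from
   above, with the common bound phi. *)
have [E1 [mE1 pE1 HE1]] := good_event P l
  (fun t => upper_tail (Wquad (-1) (lattice_pt t) (qform Sig (lattice_pt t))) tau) p
  (fun t => mb _ _ _) (fun t => pr _ _ _ (normrN1 R) (lexx _)).
have dv j : qform Sig (delta_vec j) <= phi by rewrite qform_delta_vec; exact: diag_le.
have [E2 [mE2 pE2 HE2]] := good_event P (enum 'I_d)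
  (fun j => upper_tail (Wquad 1 (delta_vec j) phi) tau) p
  (fun t => mb _ _ _) (fun j => pr _ _ _ (normr1 R) (dv j)).
exists (E1 `&` E2); split; first exact: measurableI.
  apply: le_trans (good_eventI P _ _ _ _ mE1 mE2 pE1 pE2) _.
  rewrite lee_fin lsz size_enum_ord.
  have hC := @bin_le_sparse_entropy R d s sd; rewrite -/L in hC.
  have hd : d%:R <= expR L.
    have dp : 0 < d%:R :> R by rewrite ltr0n.
    by rewrite -[d%:R]lnK ?posrE // ler_expR; exact: ln_le_sparse_entropy.
  have hp : p <= expR (- (6 * (L + ln (delta^-1)))).
    by rewrite ler_expR lerN2 ler_wpM2l.
  (* Either family has at most exp(3 L) members, of probability at most exp(-6 L) times a factor at
     most delta. As L >= 1, this leaves exp(-3) delta, so each family costs at most delta / 4. *)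
  have e3 : expR (- 3) <= 4^-1 :> R.
    by rewrite expRN lef_pV2 ?posrE ?expR_gt0 //; have := expR_ge1Dx (3 : R); lra.
  have fin (x : R) : x <= expR (3 * L) -> 0 <= x -> x * p <= 4^-1 * delta.
    move=> hx x0; apply: (@le_trans _ _ (expR (3 * L) * expR (- (6 * (L + ln (delta^-1)))))).
      by apply: ler_pM => //; exact: expR_ge0.
    apply: (@le_trans _ _ (expR (- 3) * delta)); last first.
      by apply: ler_wpM2r => //; case/andP: delta01 => h _; exact: ltW.
    by rewrite -[X in _ <= _ * X]delta_exp -!expRD ler_expR; have := L1; have := ld0; lra.
  have f1 := fin _ hC (ler0n _ _).
  have f2 := fin d%:R (le_trans hd _) (ler0n _ _).
  have {}f2 : d%:R * p <= 4^-1 * delta.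
    by apply: f2; rewrite ler_expR; have := L1; lra.
  lra.
move=> w [w1 w2] v cv.
have upper j : empirical_gram Rs Xs w j j <= SigR j j + 112 * K ^+ 2 * tau * phi.
  have := not_upper_tail_Wquad _ _ _ _ _ phi0 (HE2 w w2 j (mem_enum _ _)).
  by rewrite !mul1r !qform_delta_vec => /ltW.
have lower t : size t = s.+1 ->
    qform SigR (lattice_pt t) - 112 * K ^+ 2 * tau * qform Sig (lattice_pt t)
      <= qform (empirical_gram Rs Xs w) (lattice_pt t).
  move=> /lrep[u ul /perm_lattice_pt ->].
  (* For a vector of zero variance the tail event carries no information, but then the population
     form SigR vanishes as well. *)
  have [a0|a0] := leP (qform Sig (lattice_pt u)) 0.
    have -> : qform Sig (lattice_pt u) = 0 by apply/eqP; rewrite eq_le a0 psd.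
    rewrite mulr0 subr0; apply: le_trans (le_trans (qformR_le _) a0) _.
    rewrite qform_empirical_gram mulr_ge0 ?invr_ge0 //; apply: sumr_ge0 => i _.
    by rewrite mulr_ge0 ?sqr_ge0.
  by have := not_upper_tail_Wquad _ _ _ _ _ a0 (HE1 w w1 u ul); lra.
have eta0 : 0 <= 112 * K ^+ 2 * tau.
  by apply: mulr_ge0; [apply: mulr_ge0 => //; exact: sqr_ge0|exact: (andP tau01).1].
pose e := 112 * K ^+ 2 * tau * phi.
have main : qform SigR v - e * (norm2 v ^+ 2 + 3 * (norm1 v ^+ 2 / s%:R))
    <= qform (empirical_gram Rs Xs w) v.
  have := @qform_empirical_ge R d Sig SigR (empirical_gram Rs Xs w) s phi _
    (moment2_sym _ _ _) (moment2_sym _ _ _) (emp_sym w) s1 (ltW phi0) eta0 psd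
    (qform_le_phi_sparse s) lower upper v.
  by rewrite -[3 * _ / _]mulrA.
have n1 := cone1_norm1 _ _ cv; have n2 := sum_supp_le_norm2 beta0 v.
have N0 : 0 <= norm2 v by exact: sqrtr_ge0.
have B0 : 0 <= norm1 v by apply: sumr_ge0.
have sp : 0 < s%:R :> R by rewrite ltr0n.
have nn : norm1 v ^+ 2 / s%:R <= 16 * norm2 v ^+ 2.
  rewrite ler_pdivrMr //.
  have h : norm1 v <= 4 * (Num.sqrt s%:R * norm2 v) by apply: le_trans n1 _; rewrite ler_wpM2l.
  have : norm1 v ^+ 2 <= (4 * (Num.sqrt s%:R * norm2 v)) ^+ 2.
    by rewrite lerXn2r ?nnegrE ?mulr_ge0 ?sqrtr_ge0.
  by rewrite !exprMn sqr_sqrtr ?(ltW sp) //; lra.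
have N2 : 0 <= norm2 v ^+ 2 by exact: sqr_ge0.
have e0 : 0 <= e by apply: mulr_ge0 => //; exact: ltW.
have h1 := ler_wpM2l e0 nn; have h2 := REpop_scaled _ cv.
(* On the cone the total loss is (1 + 3 * 16) e = 49 e times |v|_2^2, and 98 makes it half of
   kappa^2. *)
have h3 : 98 * e * norm2 v ^+ 2 <= kappa ^+ 2 * norm2 v ^+ 2.
  apply: ler_wpM2r => //; apply: le_trans tau_phi.
  by rewrite le_eqVlt; apply/orP; left; apply/eqP; rewrite /e; ring.
apply: le_trans main; move: h1 h2 h3.
move: (norm2 v ^+ 2) (norm1 v ^+ 2 / s%:R) (qform SigR v) (kappa ^+ 2) (e) => N B q k e'.
lra.
Qed.

(** * The noise level for part (b) *)

Variable sigma : R.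
Let eps w := Y w - dotv (at_ X w) beta0.
Hypothesis sigma0 : 0 <= sigma.
Hypothesis ce1 : cond_exp_version P X eps (fun=> 0).
Hypothesis ci : cond_indep_given P X Rv Y.
Hypothesis psi2_eps : (psi2 P eps <= (K * sigma)%:E)%E.
Let phi1 := phi_sparse P X 1.
Let tau1 : R := Num.sqrt (ln (d%:R / delta) / n%:R).
Let lam : R := 448 * K ^+ 2 * sigma * Num.sqrt (phi1 * ln (d%:R / delta) / n%:R).
Hypothesis lam0 : 0 < lam.
Hypothesis d3 : (3 <= d)%N.

Let meps : measurable_fun setT eps.
Proof. by apply: measurable_funB => //; exact: mdotv. Qed.

Let dp : 0 < d%:R :> R.
Proof. by rewrite ltr0n; exact: leq_trans d3. Qed.

Let ln_d_delta : ln (d%:R / delta) = ln d%:R + ln (delta^-1).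
Proof. by case/andP: delta01 => h _; rewrite lnM // posrE // invr_gt0. Qed.

Let ln_d0 : 0 <= ln d%:R :> R.
Proof. by apply: ln_ge0; rewrite ler1n; exact: leq_trans d3. Qed.

Let ln_d_delta0 : 0 <= ln (d%:R / delta) / n%:R.
Proof. by rewrite divr_ge0 ?(ltW np) // ln_d_delta addr_ge0. Qed.

(** The sample-size condition also keeps the noise in the Gaussian range, because log(d / delta) <=
    L + log(1 / delta) <= n tau^2. *)
Let tau1_01 : 0 <= tau1 <= 1.
Proof.
rewrite sqrtr_ge0 /= -[leRHS]sqrtr1; apply: ler_wsqrtr.
rewrite ler_pdivrMr // mul1r ln_d_delta.
apply: (@le_trans _ _ (L + ln (delta^-1))); first by rewrite lerD2r; exact: ln_le_sparse_entropy.
apply: le_trans entropy_le_tau _; case/andP: tau01 => t0 t1.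
by rewrite -[leRHS]mulr1 ler_wpM2l ?(ltW np) // expr_le1.
Qed.

Let sigma_gt0 : 0 < sigma.
Proof.
rewrite lt0r sigma0 andbT; apply/eqP => e; move: lam0.
by rewrite /lam e mulr0 mul0r ltxx.
Qed.

(** A positive [lam] forces this, as [Num.sqrt] is 0 on nonpositive arguments. *)
Let phi1_gt0 : 0 < phi1.
Proof.
rewrite ltNge; apply/negP => h; move: lam0.
rewrite /lam -[phi1 * _ / _]mulrA; suff -> : Num.sqrt (phi1 * (ln (d%:R / delta) / n%:R)) = 0 by rewrite !mulr0 ltxx.
by apply: ler0_sqrtr; rewrite mulr_le0_ge0.
Qed.

Let lamE : lam = 448 * K ^+ 2 * sigma * Num.sqrt phi1 * tau1.
Proof. by rewrite /lam -[phi1 * _ / _]mulrA sqrtrM ?(ltW phi1_gt0) // !mulrA. Qed.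

(** The product of the doubled Orlicz bounds 2 K sqrt(phi1) of X_j and 2 K sigma of eps. *)
Let c : R := 4 * K ^+ 2 * sigma * Num.sqrt phi1.
Let c0 : 0 < c.
Proof.
apply: mulr_gt0; last by rewrite sqrtr_gt0.
by apply: mulr_gt0 => //; apply: mulr_gt0 => //; exact: exprn_gt0.
Qed.

Definition Wnoise (sg : R) (j : 'I_d) (x : OT) : R :=
  sg * (x.1.2 * x.2 j * (x.1.1 - dotv x.2 beta0) / c).

Lemma measurable_Wnoise sg j : measurable_fun setT (Wnoise sg j).
Proof.
apply: measurable_funM => //; apply: measurable_funM => //; apply: measurable_funM.
  by apply: measurable_funM; [exact: measurable_obs2|exact: measurable_obs3].
by apply: measurable_funB; [exact: measurable_obs1|exact: measurable_obs_dotv].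
Qed.

(** A product of two sub-Gaussian variables is sub-exponential, whatever their dependence: AM-GM is
    used once in the exponent and once on the two exponentials, so the bound 2 survives. *)
Lemma exp_moment_Wnoise sg j : `|sg| = 1 ->
  (\int[P]_w (expR `|Wnoise sg j (Phi0 w)|)%:E <= 2%:E)%E.
Proof.
move=> sg1.
pose a w := X j w ^+ 2 / (4 * K ^+ 2 * phi1).
pose b w := eps w ^+ 2 / (2 * K * sigma) ^+ 2.
have ia : (\int[P]_w (expR (a w))%:E <= 2%:E)%E.
  have h : qform Sig (delta_vec j) <= phi1 by rewrite qform_delta_vec; exact: diag_le.
  have := exp_moment_dotv (delta_vec j) phi1 h phi1_gt0.
  by under eq_integral do rewrite dotv_delta_vec.
have ib : (\int[P]_w (expR (b w))%:E <= 2%:E)%E.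
  apply: (psi2_expectation_le2 P eps (K * sigma)) => //.
  by have := mulr_gt0 K0 sigma_gt0; lra.
have ma : measurable_fun setT (fun w => expR (a w)).
  by apply: measurableT_comp => //; apply: measurable_funM => //; exact: measurable_funX.
have mb : measurable_fun setT (fun w => expR (b w)).
  by apply: measurableT_comp => //; apply: measurable_funM => //; exact: measurable_funX.
have pw w : expR `|Wnoise sg j (Phi0 w)| <= 2^-1 * (expR (a w) + expR (b w)).
  have le1 : `|Wnoise sg j (Phi0 w)| <= a w / 2 + b w / 2.
    rewrite /Wnoise normrM sg1 mul1r /= -/(eps w) normrM (gtr0_norm (_ : 0 < c^-1)) ?invr_gt0 //.
    have /andP[r0 r1] := Rv01 w.
    have h1 : `|Rv w * X j w * eps w| <= `|X j w| * `|eps w|.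
      rewrite !normrM (ger0_norm r0) -mulrA -[leRHS]mul1r ler_wpM2r // mulr_ge0 //.
    have sp : 0 < Num.sqrt phi1 by rewrite sqrtr_gt0.
    pose p := `|X j w| / (2 * K * Num.sqrt phi1); pose q := `|eps w| / (2 * K * sigma).
    have pE : a w = p ^+ 2.
      rewrite /a /p expr_div_n real_normK ?num_real // exprMn sqr_sqrtr ?(ltW phi1_gt0) //.
      by congr (_ / _); ring.
    have qE : b w = q ^+ 2 by rewrite /b /q expr_div_n real_normK ?num_real.
    have pqE : `|X j w| * `|eps w| / c = p * q.
      by rewrite /p /q /c; field; rewrite !gt_eqF.
    apply: (@le_trans _ _ (`|X j w| * `|eps w| / c)).
      by apply: ler_wpM2r => //; rewrite invr_ge0 ltW.
    by rewrite pqE pE qE; have := sqr_ge0 (p - q); rewrite sqrrB; lra.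
  apply: (@le_trans _ _ (expR (a w / 2 + b w / 2))); first by rewrite ler_expR.
  have e2 (x : R) : expR x = expR (x / 2) ^+ 2 by rewrite expr2 -expRD; congr expR; lra.
  rewrite expRD (e2 (a w)) (e2 (b w)).
  by have := sqr_ge0 (expR (a w / 2) - expR (b w / 2)); rewrite sqrrB; lra.
apply: (@le_trans _ _ (\int[P]_w (2^-1%:E * ((expR (a w))%:E + (expR (b w))%:E)))%E).
  apply: ge0_le_integral => //.
  - apply/measurable_EFinP; apply: measurableT_comp => //; apply: measurableT_comp => //.
    exact: (measurableT_comp (measurable_Wnoise sg j) mPhi0).
  - apply/(@measurable_EFinP _ _ _ _ (fun w => 2^-1 * (expR (a w) + expR (b w)))).
    by apply: measurable_funM => //; exact: measurable_funD.
  - by move=> w _; rewrite -EFinD -EFinM lee_fin.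
rewrite ge0_integralZl_EFin //; last 2 first.
- by move=> w _; rewrite -EFinD lee_fin addr_ge0 ?expR_ge0.
- apply/(@measurable_EFinP _ _ _ _ (fun w => expR (a w) + expR (b w))).
  exact: measurable_funD.
rewrite ge0_integralD //; try (by move=> w _; rewrite lee_fin expR_ge0); try exact/measurable_EFinP.
apply: (@le_trans _ _ (2^-1%:E * (2%:E + 2%:E))%E).
  by apply: lee_wpmul2l; [rewrite lee_fin|exact: leeD].
by rewrite -EFinD -EFinM lee_fin; lra.
Qed.

Let Wnoise_E sg j w : Wnoise sg j (Phi0 w) = sg / c * (Rv w * X j w * eps w).
Proof.
rewrite (_ : Wnoise sg j (Phi0 w) = sg * (Rv w * X j w * eps w / c)) //; ring.
Qed.

(** X_j is split into its parts because [missing_at_random_mean0] takes a nonnegative multiplier;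
    integrability of R X_j eps comes from the exponential moment. *)
Lemma mean_Wnoise sg j : (\int[P]_w (Wnoise sg j (Phi0 w))%:E = 0)%E.
Proof.
have mRX : measurable_fun setT (fun w => Rv w * X j w) by exact: measurable_funM.
have iRXe : P.-integrable setT (fun w => (Rv w * X j w * eps w)%:E).
  have iW : P.-integrable setT (fun w => (Wnoise 1 j (Phi0 w))%:E).
    apply: integrable_of_expR_norm; first exact: (measurableT_comp (measurable_Wnoise 1 j) mPhi0).
    by apply: exp_moment_Wnoise; exact: normr1.
  apply: (eq_integrable measurableT (fun w => c%:E * (Wnoise 1 j (Phi0 w))%:E)%E); last exact: integrableZl.
  by move=> w _; rewrite -EFinM Wnoise_E; congr EFin; field; rewrite gt_eqF.
have me : measurable_fun setT (eps : g_sigma_algebraType (genXY X Y) -> R).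
  apply: measurable_funB; first exact: measurable_Y_SXY.
  apply: measurable_SX_SXY; apply: measurable_sum => k; apply: measurable_funM => //.
  exact: measurable_X_SX.
pose xp w := Num.max (X j w) 0; pose xn w := Num.max (- X j w) 0.
have xpn w : X j w = xp w - xn w.
  by rewrite /xp /xn; case: (leP (X j w) 0) => h; case: (leP (- X j w) 0) => h'; lra.
have xp0 w : 0 <= xp w by rewrite /xp le_max lexx orbT.
have xn0 w : 0 <= xn w by rewrite /xn le_max lexx orbT.
have xp_le w : xp w <= `|X j w| by rewrite /xp ge_max ler_norm normr_ge0.
have xn_le w : xn w <= `|X j w| by rewrite /xn ge_max normr_ge0 andbT -normrN ler_norm.
have mXj := measurable_X_SX X j.
have mxp : measurable_fun setT (xp : g_sigma_algebraType (cylX X) -> R) by exact: measurable_maxr.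
have mxn : measurable_fun setT (xn : g_sigma_algebraType (cylX X) -> R).
  by apply: measurable_maxr => //; exact: measurableT_comp.
have dom (x : T -> R) : measurable_fun setT (x : g_sigma_algebraType (cylX X) -> R) ->
    (forall w, 0 <= x w) -> (forall w, x w <= `|X j w|) ->
    P.-integrable setT (fun w => (Rv w * x w * eps w)%:E).
  move=> mx x0 xX; have mx' := measurable_of_SX X mX x mx.
  apply: (le_integrable measurableT _ _ iRXe).
    by apply/measurable_EFinP; apply: measurable_funM => //; exact: measurable_funM.
  move=> w _ /=; rewrite lee_fin !normrM ler_wpM2r // ler_wpM2l //.
  by rewrite ger0_norm.
have ip := dom _ mxp xp0 xp_le; have im := dom _ mxn xn0 xn_le.
have zp := missing_at_random_mean0 P X mX Rv Y mR mY R01 ci xp eps mxp xp0 me ce1 ip.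
have zn := missing_at_random_mean0 P X mX Rv Y mR mY R01 ci xn eps mxn xn0 me ce1 im.
under eq_integral do rewrite Wnoise_E EFinM.
rewrite integralZl //.
have -> : (\int[P]_w (Rv w * X j w * eps w)%:E =
    \int[P]_w ((Rv w * xp w * eps w)%:E - (Rv w * xn w * eps w)%:E))%E.
  apply: eq_integral => w _; rewrite -EFinB xpn; congr EFin.
  by move: (eps w) (xp w) (xn w) => e a b; ring.
by rewrite (integralB measurableT ip im) zp zn sube0 mule0.
Qed.

Lemma noise_event : exists E, [/\ measurable E, (P (~` E) <= (delta / 2)%:E)%E &
  forall w, E w -> 4 / n%:R * norminf (fun j => \sum_(i < n) Rs i w * Xs i j w *
    (Ys i w - dotv (at_ (Xs i) w) beta0)) <= lam].
Proof.
pose p := expR (- (6 * (n%:R * tau1 ^+ 2))).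
pose S (q : bool * 'I_d) := upper_tail (Wnoise ((-1) ^+ q.1) q.2) tau1.
have sgn (q : bool) : `|(-1) ^+ q| = 1 :> R by rewrite normrX normrN1 expr1n.
have [E [mE pE HE]] := good_event P (enum {: bool * 'I_d}) S p
  (fun q => measurable_upper_tail _ _ (measurable_Wnoise _ _))
  (fun q => prob_upper_tail _ _ (measurable_Wnoise _ _) (exp_moment_Wnoise _ q.2 (sgn q.1)) tau1_01).
exists E; split => //.
  apply: le_trans pE _; rewrite lee_fin -cardE card_prod card_bool card_ord.
  have -> : p = expR (- (6 * (ln d%:R + ln delta^-1))).
    have e : n%:R * tau1 ^+ 2 = ln d%:R + ln delta^-1.
      by rewrite sqr_sqrtr // mulrC divfK ?gt_eqF.
    by rewrite /p e.
  apply: (@le_trans _ _ ((2 * d)%:R * (expR (- (3 * ln d%:R)) * delta))).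
    apply: ler_wpM2l => //; rewrite -[X in _ <= _ * X]delta_exp -expRD ler_expR.
    by have := ln_d0; have := ld0; lra.
  have e3 : expR (- (3 * ln d%:R)) = (d%:R ^+ 3)^-1 :> R.
    by rewrite expRN expRM_natl lnK // posrE.
  (* There are 2d events, two signs per coordinate, each of probability at most delta / d^3; d >= 3
     makes 2d / d^3 at most 1/2. *)
  rewrite e3 mulrA [leRHS]mulrC; apply: ler_wpM2r; first by case/andP: delta01 => h _; exact: ltW.
  rewrite ler_pdivrMr ?exprn_gt0 // natrM.
  have d3' : 3 <= d%:R :> R by rewrite (ler_nat R 3 d).
  have d2 : 3 ^+ 2 <= d%:R ^+ 2 :> R by rewrite lerXn2r ?nnegrE //; lra.
  by rewrite exprS; have := ler_wpM2l (ltW dp) d2; lra.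
move=> w Ew.
set u := fun j => _.
have uj j : `|u j| <= n%:R * (28 * tau1) * c.
  have h (b : bool) : (-1) ^+ b * u j <= n%:R * (28 * tau1) * c.
    have := HE w Ew (b, j) (mem_enum _ _); rewrite /S /upper_tail /= mean_Wnoise add0r.
    move=> /negP; rewrite -ltNge => /ltW.
    have -> : \sum_(i < n) Wnoise ((-1) ^+ b) j (Phi i w) = (-1) ^+ b * u j / c.
      rewrite /u mulr_sumr mulr_suml; apply: eq_bigr => i _.
      rewrite (_ : Wnoise _ _ _ = (-1) ^+ b *
        (Rs i w * Xs i j w * (Ys i w - dotv (at_ (Xs i) w) beta0) / c)) //.
      by rewrite !mulrA.
    by rewrite ler_pdivrMr.
  rewrite ler_norml; have := h true; have := h false.
  by rewrite expr0 expr1 mul1r mulN1r; lra.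
have ni : norminf u <= n%:R * (28 * tau1) * c.
  apply: bigmax_le => // ; apply: mulr_ge0; last exact: ltW.
  by apply: mulr_ge0; [exact: ltW|apply: mulr_ge0 => //; exact: sqrtr_ge0].
have n4 : 0 <= 4 / n%:R :> R by rewrite divr_ge0 ?(ltW np).
apply: le_trans (ler_wpM2l n4 ni) _.
(* An equality: 448 = 4 * 28 * 4, from the condition on lam, the Chernoff deviation and the factor
   in [c]. *)
rewrite lamE le_eqVlt; apply/orP; left; apply/eqP; rewrite /c; field.
by rewrite gt_eqF.
Qed.

End model.

Theorem theorem3 (R : realType) (K : R) : 0 < K ->
  exists A1 A2 C : R, [/\ 0 < A1, 0 < A2, 0 < C &
  forall (dsp : measure_display) (T : measurableType dsp) (P : probability T R)
    (d n : nat)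
    (Ys Rs : 'I_n -> T -> R) (Xs : 'I_n -> 'I_d -> T -> R)
    (Y Rv : T -> R) (X : 'I_d -> T -> R)
    (beta0 : 'I_d -> R) (sigma kappa delta : R),
  let eps := fun w => Y w - dotv (at_ X w) beta0 in
  let epss := fun (i : 'I_n) w => Ys i w - dotv (at_ (Xs i) w) beta0 in
  let s := norm0 beta0 in
  (* measurability and the support {0,1} of the missingness indicator *)
  measurable_fun setT Y -> measurable_fun setT Rv ->
  (forall j, measurable_fun setT (X j)) ->
  (forall i, measurable_fun setT (Ys i)) -> (forall i, measurable_fun setT (Rs i)) ->
  (forall i j, measurable_fun setT (Xs i j)) ->
  (forall w, Rv w = 0 \/ Rv w = 1) -> (forall i w, Rs i w = 0 \/ Rs i w = 1) ->
  iid_copies P Ys Rs Xs Y Rv X ->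
  (* model: E(eps | X) = 0, E(eps^2 | X) = sigma^2 *)
  0 <= sigma ->
  cond_exp_version P X eps (fun _ => 0) ->
  cond_exp_version P X (fun w => eps w ^+ 2) (fun _ => sigma ^+ 2) ->
  (* R conditionally independent of Y given X *)
  cond_indep_given P X Rv Y ->
  (* X has finite second moments and is sub-Gaussian *)
  (forall j, P.-integrable setT (EFin \o (fun w => X j w ^+ 2))) ->
  (forall u : 'I_d -> R,
     (psi2 P (fun w => dotv (at_ X w) u)
       <= (K * Num.sqrt (fine ('E_P[fun w => (dotv (at_ X w) u ^+ 2)%R])%E))%:E)%E) ->
  (* restricted eigenvalue condition *)
  0 < kappa ->
  (forall v : 'I_d -> R, cone1 (supp beta0) 3 v -> norm2 v = 1%R ->
     (kappa ^+ 2)%:E <= 'E_P[fun w => (Rv w * dotv (at_ X w) v ^+ 2)%R])%E ->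
  (* technical: beta0 nonzero so that s_beta log(ed/s_beta) and phi_{s_beta} make sense *)
  (1 <= s)%N -> (0 < n)%N ->
  0 < delta < 1 ->
  Num.sqrt (s%:R * ln (expR 1 * d%:R / s%:R) / n%:R)
    + Num.sqrt (ln (delta^-1) / n%:R)
    < Num.min (kappa ^+ 2 / (A1 * phi_sparse P X s)) 1 ->
  (* (a) *)
  (forall lam : R, 0 < lam -> (s.+2 <= d)%N ->
     exists E : set T, [/\ measurable E, ((1 - delta)%:E <= P E)%E &
       forall w, E w ->
         4 / n%:R * norminf (fun j => \sum_(i < n) Rs i w * Xs i j w * epss i w) < lam ->
         0 < norminf (fun j => \sum_(i < n) Rs i w * Xs i j w * epss i w) ->
         forall b, is_lasso Ys Rs Xs lam w b ->
           norm2 (fun j => b j - beta0 j) <= C * Num.sqrt s%:R * lam / kappa ^+ 2]) /\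
  (* (b) *)
  ((psi2 P eps <= (K * sigma)%:E)%E -> (s.+2 <= d)%N ->
   let lam := A2 * sigma * Num.sqrt (phi_sparse P X 1 * ln (d%:R / delta) / n%:R) in
   0 < lam ->
   exists E : set T, [/\ measurable E, ((1 - delta)%:E <= P E)%E &
     forall w, E w -> forall b, is_lasso Ys Rs Xs lam w b ->
       norm2 (fun j => b j - beta0 j)
         <= C * (sigma / kappa ^+ 2)
              * Num.sqrt (phi_sparse P X 1 * s%:R * ln (d%:R / delta) / n%:R)])].
Proof.
(* Part (a) needs 3 and part (b) needs 3 * A2; their sum serves both. The 3 is 3/2 divided by the
   1/2 lost in the restricted eigenvalue. *)
move=> K0; exists (98 * 112 * K ^+ 2), (448 * K ^+ 2), (3 + 3 * (448 * K ^+ 2)).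
have K2 : 0 < K ^+ 2 by exact: exprn_gt0.
split; [by apply: mulr_gt0; [exact: mulr_gt0|]|exact: mulr_gt0|lra|].
move=> dsp T P d n Ys Rs Xs Y Rv X beta0 sigma kappa delta eps epss s.
move=> mY mR mX mYs mRs mXs R01 Rs01 iid sigma0 ce1 _ ci iX subG kappa0 RE s1 n0 delta01 tau_lt.
have [E [mE pE HE]] := restricted_eigenvalue_event P Ys Rs Xs Y Rv X K mY mR mX mYs mRs mXs R01 Rs01 iid n0 K0 iX subG
  beta0 kappa delta s1 delta01 kappa0 tau_lt RE.
have c0 : 0 < kappa ^+ 2 / 2 by apply: divr_gt0 => //; exact: exprn_gt0.
have k0 : 0 < kappa ^+ 2 by exact: exprn_gt0.
have d0 : 0 < delta by case/andP: delta01.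
have simpl_bound (l : R) : 3 / 2 * Num.sqrt s%:R * l / (kappa ^+ 2 / 2) = 3 * Num.sqrt s%:R * l / kappa ^+ 2.
  by field; rewrite gt_eqF.
split.
  (* In (a) the noise condition is imposed on the outcome, so the restricted eigenvalue event
     suffices and costs only delta / 2. *)
  move=> lam lam0 _; exists E; split => //.
    apply: le_trans (good_event_ge P E _ mE pE); rewrite lee_fin; lra.
  move=> w Ew noise _ b lb.
  have := lasso_error_bound Ys Rs Xs lam w beta0 b _ n0 lam0 c0 (fun i => Rs01 i w) (ltW noise) lb (HE w Ew).
  rewrite simpl_bound => h; apply: le_trans h _.
  apply: ler_wpM2r; first by rewrite invr_ge0 ltW.
  apply: ler_wpM2r; first exact: ltW.
  apply: ler_wpM2r; [exact: sqrtr_ge0|lra].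
move=> psi_eps sd lam lam0.
have d3 : (3 <= d)%N by apply: leq_trans sd; rewrite !ltnS.
have [E' [mE' pE' HE']] := noise_event P Ys Rs Xs Y Rv X K mY mR mX mYs mRs mXs R01 iid n0 K0 iX subG
  beta0 kappa delta s1 delta01 tau_lt sigma sigma0 ce1 ci psi_eps lam0 d3.
exists (E `&` E'); split; first exact: measurableI.
  have pEE := good_eventI P _ _ _ _ mE mE' pE pE'.
  have := good_event_ge P _ _ (measurableI _ _ mE mE') pEE.
  by rewrite -splitr.
move=> w [Ew Ew'] b lb.
have := lasso_error_bound Ys Rs Xs lam w beta0 b _ n0 lam0 c0 (fun i => Rs01 i w) (HE' w Ew') lb (HE w Ew).
rewrite simpl_bound => h; apply: le_trans h _.
rewrite /lam.
set phi1 := phi_sparse P X 1; set l := ln _.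
have -> : Num.sqrt (phi1 * s%:R * l / n%:R) = Num.sqrt s%:R * Num.sqrt (phi1 * l / n%:R).
  by rewrite -sqrtrM ?ler0n //; congr Num.sqrt; ring.
have q0 : 0 <= sigma / kappa ^+ 2 * (Num.sqrt s%:R * Num.sqrt (phi1 * l / n%:R)).
  apply: mulr_ge0; first by rewrite divr_ge0 // ltW.
  by apply: mulr_ge0; exact: sqrtr_ge0.
rewrite (_ : _ / kappa ^+ 2 = (3 * (448 * K ^+ 2)) *
  (sigma / kappa ^+ 2 * (Num.sqrt s%:R * Num.sqrt (phi1 * l / n%:R)))); last by field; rewrite gt_eqF.
by rewrite -[leRHS]mulrA; apply: ler_wpM2r => //; lra.
Qed.
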